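(* Suppose $\mathbb{K}$ is a computable age with the hereditary property (HP), the joint embedding property (JEP), and the amalgamation property (AP). Then $\mathbb{K}$ has an $\mathscr{EI}(\mathbb{K})$-computable Fraïssé limit, where $\mathscr{EI}(\mathbb{K})$ is the embedding information of $\mathbb{K}$.
   Context: Languages and structures. $\mathcal{L}$ is a countable language (relation symbols of positive arity; function symbols of any arity, 0-ary ones being constants) with a computable representation: relation symbols $R_n$ and function symbols $F_m$ are indexed bijectively by disjoint computable subsets of $\omega$, with arity computable from the index. An $\mathcal{L}$-structure $\mathcal{M}$ is c.e. if its underlying set $M$ is a c.e. subset of $\omega$ and the sets $\{(n,\mathbf a): \mathcal M\models R_n(\mathbf a)\}$, $\{(n,\mathbf a): \mathcal M\models \neg R_n(\mathbf a)\}$, $\{(m,\mathbf a,b): \mathcal M\models F_m(\mathbf a)=b\}$ are c.e.; it is computable if moreover $M$ is computable. Notions such as ''$X$-computable structure'' or ''$X$-computable age'' are obtained by relativizing to the oracle $X$. Tuples are finite; $\mathrm{cl}_{\mathcal M}(\mathbf a)$ is the smallest substructure of $\mathcal M$ containing $\mathbf a$. For tuples $\mathbf a\in\mathcal A$, $\mathbf b\in\mathcal B$ of the same length, $\mathbf a\simeq\mathbf b$ means that for every atomic $\mathcal L$-formula $\varphi$, $\mathcal A\models\varphi(\mathbf a)$ iff $\mathcal B\models\varphi(\mathbf b)$; equivalently $\mathbf a\mapsto\mathbf b$ extends to an isomorphism $\mathfrak t(\mathbf a,\mathbf b):\mathrm{cl}(\mathbf a)\to\mathrm{cl}(\mathbf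 b)$. Ages. An age is a collection of finitely generated $\mathcal L$-structures closed under isomorphism. A computable age (computable representation of an age $\mathcal K$) is a c.e. set $\mathbb K$ of triples $(\mathbf a,\mathcal A,i)$ (computable structures being given by indices), with exactly one triple for each $i\in\omega$, written $\mathbb I(i)=(\mathbf a_i,\mathcal A_i,i)$, such that each $\mathcal A_i$ is a computable $\mathcal L$-structure in $\mathcal K$ with $\mathcal A_i=\mathrm{cl}_{\mathcal A_i}(\mathbf a_i)$, and every $\mathcal B\in\mathcal K$ is isomorphic to some $\mathcal A_i$. $\mathbb K$ is said to have a property of ages if $\mathcal K$ does. The embedding information $\mathscr{EI}(\mathbb K)$ is the set of tuples $(\mathbb I(k_0),\mathbf b_0,\mathbb I(k_1),\mathbf b_1)$ with $\mathbf b_0\in\mathcal A_{k_0}$, $\mathbf b_1\in\mathcal A_{k_1}$ and $\mathbf b_0\simeq\mathbf b_1$. (HP): for all $\mathcal B\in\mathcal K$, $\mathcal A\subseteq\mathcal B$ implies $\mathcal A\in\mathcal K$. (JEP): for all $\mathcal A,\mathcal B\in\mathcal K$ there is $\mathcal C\in\mathcal K$ into which both embed. (AP): for all $\mathcal A,\mathcal B,\mathcal C\in\mathcal K$ and embeddings $f_{\mathcal B}:\mathcal A\to\mathcal B$, $f_{\mathcal C}:\mathcal A\to\mathcal C$ there are $\mathcal D\in\mathcal K$ and embeddings $\alpha_{\mathcal B}:\mathcal B\to\mathcal D$, $\alpha_{\mathcal C}:\mathcal C\to\mathcal D$ with $\alpha_{\mathcal B}\circ f_{\mathcal B}=\alpha_{\mathcal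 C}\circ f_{\mathcal C}$. Fraïssé limits. The age of a structure $\mathcal M$ is the collection of all $\mathcal L$-structures isomorphic to a finitely generated substructure of $\mathcal M$. For an oracle $X$, an $X$-computable structure $\mathcal M$ is $X$-computably ultrahomogeneous if there is an $X$-computable function $g$ which takes pairs $(\mathbf a,\mathbf b)$ of finite tuples of equal length from $\mathcal M$ and returns a code (an $X$-computable index) for a bijection of the underlying set of $\mathcal M$ with itself, such that if $\mathbf a\simeq\mathbf b$ then $g(\mathbf a,\mathbf b)$ is an automorphism of $\mathcal M$ extending $\mathfrak t(\mathbf a,\mathbf b)$. $\mathcal M$ is an $X$-computable Fraïssé limit of $\mathbb K$ if $\mathcal M$ is an $X$-computable structure that is $X$-computably ultrahomogeneous and $\mathbb K$ is an ($X$-)computable representation of the age of $\mathcal M$. *)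

(* Defs.v *)
From HB Require Import structures.
From mathcomp Require Import all_boot.

Set Implicit Arguments.
Unset Strict Implicit.
Unset Printing Implicit Defensive.

(* The partial recursive functions in an oracle, as unary functions on nat.
   Pairing is <x, y> = 2 ^ x * (2 y + 1), i.e. CodeSeq.code (x :: decode y), so
   that pickle [::] = 0, pickle (x :: s) = <x, pickle s> and pickle (x, y) = <x, <y, 0>> for
   natural numbers x, y and s : seq nat. *)
Definition npair (x y : nat) : nat := CodeSeq.code (x :: CodeSeq.decode y).
Definition nleft (n : nat) : nat := head 0 (CodeSeq.decode n).
Definition nright (n : nat) : nat := CodeSeq.code (behead (CodeSeq.decode n)).

Lemma nleftK x y : nleft (npair x y) = x.
Proof. by rewrite /nleft /npair CodeSeq.codeK. Qed.

Lemma nrightK x y : nright (npair x y) = y.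
Proof. by rewrite /nright /npair CodeSeq.codeK CodeSeq.decodeK. Qed.

Inductive prog : Type :=
  | PZero | PSucc | PId | PLeft | PRight | POracle
  | PPair of prog & prog
  | PComp of prog & prog
  | PRec of prog & prog
  | PMu of prog.

(* eval X p n m : on input n, p halts with output m, given the oracle X.
   - PRec f g: h <a, 0> = f a and h <a, k + 1> = g <a, <k, h <a, k>>>;
   - PMu f: a |-> the least k such that f <a, k> = 0, provided that f <a, i>
     is defined for all i < k. *)
Fixpoint eval (X : nat -> Prop) (p : prog) (n m : nat) {struct p} : Prop :=
  match p with
  | PZero => m = 0
  | PSucc => m = n.+1
  | PId => m = n
  | PLeft => m = nleft n
  | PRight => m = nright n
  | POracle => X n /\ m = 1 \/ ~ X n /\ m = 0
  | PPair f g => exists u v, [/\ eval X f n u, eval X g n v & m = npair u v]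
  | PComp f g => exists2 u, eval X g n u & eval X f u m
  | PRec f g =>
      let fix h (k v : nat) {struct k} : Prop :=
        match k with
        | 0 => eval X f (nleft n) v
        | k'.+1 =>
            exists2 u, h k' u & eval X g (npair (nleft n) (npair k' u)) v
        end in
      h (nright n) m
  | PMu f =>
      eval X f (npair n m) 0 /\
      (forall k, k < m -> exists v, eval X f (npair n k) v.+1)
  end.

Fixpoint encode (p : prog) : nat :=
  match p with
  | PZero => npair 0 0
  | PSucc => npair 1 0
  | PId => npair 2 0
  | PLeft => npair 3 0
  | PRight => npair 4 0
  | POracle => npair 5 0
  | PPair f g => npair 6 (npair (encode f) (encode g))
  | PComp f g => npair 7 (npair (encode f) (encode g))
  | PRec f g => npair 8 (npair (encode f) (encode g))
  | PMu f => npair 9 (encode f)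
  end.

Lemma npair_inj x y x' y' : npair x y = npair x' y' -> x = x' /\ y = y'.
Proof.
by move=> e; split;
  [rewrite -(nleftK x y) e nleftK | rewrite -(nrightK x y) e nrightK].
Qed.

Lemma encode_inj : injective encode.
Proof.
elim=> [|||||| f IHf g IHg | f IHf g IHg | f IHf g IHg | f IHf]
  [|||||| f' g' | f' g' | f' g' | f'] //= /npair_inj [] // _.
- by case/npair_inj=> /IHf -> /IHg ->.
- by case/npair_inj=> /IHf -> /IHg ->.
- by case/npair_inj=> /IHf -> /IHg ->.
- by move=> /IHf ->.
Qed.

(* The partial function with index e; nowhere defined if e is not a code. *)
Definition Phi (X : nat -> Prop) (e n m : nat) : Prop :=
  exists2 p, encode p = e & eval X p n m.

Definition no_oracle : nat -> Prop := fun _ => False.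

Definition coded (T : countType) (S : T -> Prop) : nat -> Prop :=
  fun n => exists2 x, S x & pickle x = n.

Definition decides (X : nat -> Prop) (e : nat) (S : pred nat) : Prop :=
  forall n, Phi X e n (S n).

(* e is an index of a total function enumerating S: at stage s the output is
   x + 1 if the element coded by x is enumerated, and 0 if nothing is. *)
Definition enumerates (X : nat -> Prop) (e : nat) (T : countType)
    (S : T -> Prop) : Prop :=
  (forall s, exists m, Phi X e s m) /\
  (forall n, coded S n <-> exists s, Phi X e s n.+1).

Definition ce (X : nat -> Prop) (T : countType) (S : T -> Prop) : Prop :=
  exists e, enumerates X e S.

(* The symbols are their own indices. *)
Record language : Type := Language {
  rsym : pred nat;
  fsym : pred nat;
  rfdisj : forall n, ~~ (rsym n && fsym n);
  rar : {n : nat | rsym n} -> nat;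
  far : {m : nat | fsym m} -> nat;
  rar_gt0 : forall R, 0 < rar R
}.
Arguments rar {l} R.
Arguments far {l} F.

Definition computable_language (L : language) : Prop :=
  [/\ exists e, decides no_oracle e (rsym L),
      exists e, decides no_oracle e (fsym L),
      exists e, forall R, Phi no_oracle e (val R) (@rar L R) &
      exists e, forall F, Phi no_oracle e (val F) (@far L F)].

Record interp (L : language) (C : Type) : Type := Interp {
  rint : forall R : {n : nat | rsym L n}, (rar R).-tuple C -> Prop;
  fint : forall F : {m : nat | fsym L m}, (far F).-tuple C -> C
}.

Record structure (L : language) : Type := Structure {
  carrier :> Type;
  sint : interp L carrier
}.

Definition srel (L : language) (A : structure L) := @rint L A (@sint L A).
Definition sfun (L : language) (A : structure L) := @fint L A (@sint L A).
Arguments srel {L} A R t.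
Arguments sfun {L} A F t.

Section Structures.
Variable L : language.
Implicit Types A B : structure L.

Definition embedding A B (f : A -> B) : Prop :=
  [/\ injective f,
      forall R t, srel A R t <-> srel B R (map_tuple f t) &
      forall F t, f (sfun A F t) = sfun B F (map_tuple f t)].

Definition isomorphism A B (f : A -> B) : Prop :=
  embedding f /\ bijective f.

Definition isomorphic A B : Prop := exists f : A -> B, isomorphism f.

Definition closed A (S : A -> Prop) : Prop :=
  forall F (t : (far F).-tuple A), (forall i, S (tnth t i)) -> S (sfun A F t).

Fact map_sval_sub A (S : A -> Prop) n (t : n.-tuple {x : A | S x}) i :
  S (tnth (map_tuple sval t) i).
Proof. by rewrite tnth_map; apply: proj2_sig. Qed.

Definition substructure A (S : A -> Prop) (cS : closed S) : structure L :=
  @Structure L {x : A | S x}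
    (@Interp L {x : A | S x}
       (fun R t => srel A R (map_tuple sval t))
       (fun F t => exist S (sfun A F (map_tuple sval t))
                           (cS F _ (map_sval_sub t)))).

Definition cl A n (a : n.-tuple A) (x : A) : Prop :=
  forall S : A -> Prop, closed S -> (forall i, S (tnth a i)) -> S x.

Fact cl_closed A n (a : n.-tuple A) : closed (cl a).
Proof.
by move=> F t clt S cS aS; apply: (cS) => i; apply: clt.
Qed.

Definition clS A n (a : n.-tuple A) : structure L :=
  substructure (cl_closed (a := a)).

Definition generates A n (a : n.-tuple A) : Prop := forall x, cl a x.

Definition finitely_generated A : Prop :=
  exists n (a : n.-tuple A), generates a.

Inductive term (n : nat) : Type :=
  | Var of 'I_n
  | App (F : {m : nat | fsym L m}) of ('I_(far F) -> term n).

Inductive atomic (n : nat) : Type :=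
  | Equal of term n & term n
  | Rel (R : {k : nat | rsym L k}) of ('I_(rar R) -> term n).

Fixpoint tval A n (a : n.-tuple A) (t : term n) : A :=
  match t with
  | Var i => tnth a i
  | App F ts => sfun A F [tuple tval a (ts i) | i < far F]
  end.

Definition satisfies A n (a : n.-tuple A) (phi : atomic n) : Prop :=
  match phi with
  | Equal t u => tval a t = tval a u
  | Rel R ts => srel A R [tuple tval a (ts i) | i < rar R]
  end.

Definition simeq A B n (a : n.-tuple A) (b : n.-tuple B) : Prop :=
  forall phi : atomic n, satisfies a phi <-> satisfies b phi.

Definition is_transfer A B n (a : n.-tuple A) (b : n.-tuple B)
    (f : clS a -> clS b) : Prop :=
  isomorphism f /\ (forall i x, sval x = tnth a i -> sval (f x) = tnth b i).

Definition extends_transfer A n (a b : n.-tuple A) (h : A -> A) : Prop :=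
  exists2 f : clS a -> clS b, is_transfer f & forall x, h (sval x) = sval (f x).

Definition is_age (K : structure L -> Prop) : Prop :=
  (forall A, K A -> finitely_generated A) /\
  (forall A B, K A -> isomorphic A B -> K B).

Definition age_of A : structure L -> Prop :=
  fun B => exists n (a : n.-tuple A), isomorphic B (clS a).

(* Members of an age are finitely generated, so HP only concerns the finitely
   generated substructures. *)
Definition HP (K : structure L -> Prop) : Prop :=
  forall B, K B -> forall (S : B -> Prop) (cS : closed S),
  finitely_generated (substructure cS) -> K (substructure cS).

Definition JEP (K : structure L -> Prop) : Prop :=
  forall A B, K A -> K B ->
  exists C, [/\ K C, exists f : A -> C, embedding f &
                     exists g : B -> C, embedding g].

Definition AP (K : structure L -> Prop) : Prop :=
  forall A B C, K A -> K B -> K C ->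
  forall (fB : A -> B) (fC : A -> C), embedding fB -> embedding fC ->
  exists D, K D /\
  exists (aB : B -> D) (aC : C -> D),
    [/\ embedding aB, embedding aC & forall x, aB (fB x) = aC (fC x)].

Record wstructure : Type := WStructure {
  dom : pred nat;
  wint : interp L {x : nat | dom x}
}.

Definition wstr (M : wstructure) : structure L := Structure (wint M).
Coercion wstr : wstructure >-> structure.

Definition nats (M : wstructure) n (a : n.-tuple M) : seq nat :=
  [seq val (x : {x : nat | dom M x}) | x <- a].

Definition rel_graph (M : wstructure) (p : nat * seq nat) : Prop :=
  exists R t, srel M R t /\ p = (val R, nats t).

Definition nrel_graph (M : wstructure) (p : nat * seq nat) : Prop :=
  exists R t, ~ srel M R t /\ p = (val R, nats t).

Definition fun_graph (M : wstructure) (p : nat * seq nat * nat) : Prop :=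
  exists F t,
    p = (val F, nats t, val (sfun M F t : {x : nat | dom M x})).

(* The domain is not also listed by an enumeration index: being decided by Phi X
   eM, it is c.e. *)
Definition structure_index (X : nat -> Prop) (e : nat) (M : wstructure) :
    Prop :=
  exists eM eR eN eF : nat,
    [/\ e = pickle [:: eM; eR; eN; eF],
        decides X eM (dom M),
        enumerates X eR (rel_graph M),
        enumerates X eN (nrel_graph M) &
        enumerates X eF (fun_graph M)].

Definition computable_structure (X : nat -> Prop) (M : wstructure) : Prop :=
  exists e, structure_index X e M.

(* (a, e, i), where e is an index of the structure generated by a. *)
Definition triple : countType := (seq nat * nat * nat)%type.

Definition computable_age (KK : triple -> Prop) (K : structure L -> Prop) :
    Prop :=
  [/\ ce no_oracle KK,
      forall i : nat, exists! ae : seq nat * nat, KK (ae, i),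
      forall a e i, KK (a, e, i) ->
        exists A : wstructure,
          [/\ structure_index no_oracle e A, K A &
              exists n (t : n.-tuple A), nats t = a /\ generates t] &
      forall B, K B ->
        exists a e i (A : wstructure),
          [/\ KK (a, e, i), structure_index no_oracle e A & isomorphic B A]].

Definition EI (KK : triple -> Prop)
    (q : triple * seq nat * triple * seq nat) : Prop :=
  exists (a0 a1 : seq nat) (e0 e1 k0 k1 : nat) (A0 A1 : wstructure) (n : nat)
         (b0 : n.-tuple A0) (b1 : n.-tuple A1),
    [/\ KK (a0, e0, k0) /\ structure_index no_oracle e0 A0,
        KK (a1, e1, k1) /\ structure_index no_oracle e1 A1,
        simeq b0 b1 &
        q = ((a0, e0, k0), nats b0, (a1, e1, k1), nats b1)].

Definition computably_ultrahomogeneous (X : nat -> Prop) (M : wstructure) :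
    Prop :=
  exists g : nat, forall n (a b : n.-tuple M),
  exists v (h : M -> M),
    [/\ Phi X g (pickle (nats a, nats b)) v,
        forall x : {x : nat | dom M x},
          Phi X v (val x) (val (h x : {x : nat | dom M x})),
        bijective h &
        simeq a b -> isomorphism h /\ extends_transfer a b h].

Definition computable_Fraisse_limit (X : nat -> Prop) (KK : triple -> Prop)
    (M : wstructure) : Prop :=
  [/\ computable_structure X M,
      computably_ultrahomogeneous X M &
      computable_age KK (age_of M)].

End Structures.

(* Main.v *)
Require Import Defs.
From mathcomp Require Import all_boot.
From mathcomp Require Import boolp.

(* The limit is approximated by tuples d_s of s + 1 elements of members A_(k_s) of
   the age, where d_s and the first s + 1 entries of d_(s+1) have the same atomic
   type.  Stage s looks at one task (J, l, b, x): if the subtuple d_s[J] has the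
   atomic type of b in A_l, then HP and AP provide A_k containing a copy of d_s
   and an element y such that J, y has the atomic type of b, x; they are found by
   a search that uses the embedding information.  An element of the limit is a
   position i, represented by the least position eventually equal to it, and the
   structure is read off from late stages; no embeddings between the A_(k_s) have
   to be remembered.  Tasks with A_l = A_(k_s) and J all positions make the limit
   closed under the function symbols, and tasks in general give both universality
   (starting from empty tuples, which agree by JEP) and the one-point extension
   property.  As the embedding information also decides whether two tuples of the
   limit have the same atomic type, a back-and-forth search computes the
   automorphisms. *)

Set Implicit Arguments.
Unset Strict Implicit.
Unset Printing Implicit Defensive.

(** * Closure properties of the computable functions *)

Arguments npair : simpl never.
Arguments nleft : simpl never.
Arguments nright : simpl never.

(** Every decision in the construction is a comparison of atomic types of tuples in two members of
    the age, hence one oracle query; even membership of x in A_k is the query comparing x with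
    itself. The relations and functions of A_k, however, come as enumeration indices that change
    with the stage, so oracle-free programs must be evaluated uniformly in their index. This is done
    without a universal program: a search guesses a finite halting certificate, which one fixed
    program checks. The other obstacle is that the atomic type of a tuple speaks of terms whose
    values may lie outside the tuple. Such values enter the limit only later, so no fixed stage need
    reflect the operations of the limit; comparisons move to a stage late enough for the formula at
    hand and return by coherence. The functions of the limit are therefore defined by a
    non-effective choice, and their graphs are shown c.e. afterwards. *)

Lemma pickle_pair (T U : countType) (x : T) (y : U) :
  pickle (x, y) = npair (pickle x) (npair (pickle y) 0).
Proof. by rewrite /npair !CodeSeq.codeK; reflexivity. Qed.

Lemma pickle_cons (T : countType) (x : T) s :
  pickle (x :: s) = npair (pickle x) (pickle s).
Proof. by rewrite /npair !CodeSeq.codeK; reflexivity. Qed.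

Lemma npairE x y : npair x y = 2 ^ x * y.*2.+1.
Proof. by rewrite /npair /= CodeSeq.decodeK. Qed.

Lemma npair_gt0 x y : 0 < npair x y.
Proof. by rewrite npairE muln_gt0 expn_gt0. Qed.

Lemma ltn_npairr x y : y < npair x y.
Proof.
by rewrite npairE -[y.+1]mul1n leq_mul ?expn_gt0 // ltnS -addnn leq_addr.
Qed.

(** Provides an iteration count for [cmp_foldl]: the code of a list, a number at hand, bounds its
    length. *)
Lemma size_pickle (T : countType) (s : seq T) : size s <= pickle s.
Proof.
elim: s => //= x s IHs; rewrite pickle_cons.
exact: leq_ltn_trans IHs (ltn_npairr _ _).
Qed.

Lemma codedP (T : countType) (S : T -> Prop) x : coded S (pickle x) <-> S x.
Proof. by split=> [[y Sy /(pcan_inj pickleK)<-] //|]; exists x. Qed.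

Fixpoint const_prog (n : nat) : prog :=
  if n is k.+1 then PComp PSucc (const_prog k) else PZero.

Lemma eval_const X n x : eval X (const_prog n) x n.
Proof. by elim: n => //= n IHn; exists n. Qed.

(** The program is constrained on codes of elements only and may diverge elsewhere. Inverting
    [pickle] is a separate matter, handled by [decodable]. *)
Definition computable X (T U : countType) (f : T -> U) : Prop :=
  exists p, forall x, eval X p (pickle x) (pickle (f x)).
Arguments computable X {T U} f.

(* The hints use the ssreflect [apply:], whose unification, unlike that of [auto],
   infers the countType structures. *)
Create HintDb cmp.

Section Computable.
Variable X : nat -> Prop.
Implicit Types T U V W : countType.

Local Notation cmp := (computable X).

Lemma cmp_ext T U (f g : T -> U) : f =1 g -> cmp f -> cmp g.
Proof. by move=> fg [p hp]; exists p => x; rewrite -fg. Qed.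

Lemma cmp_id T : cmp (fun x : T => x).
Proof. by exists PId. Qed.

Lemma cmp_cst T U (c : U) : cmp (fun _ : T => c).
Proof. by exists (const_prog (pickle c)) => x; apply: eval_const. Qed.

Lemma cmp_comp T U V (f : U -> V) (g : T -> U) :
  cmp f -> cmp g -> cmp (fun x => f (g x)).
Proof.
by move=> [p hp] [q hq]; exists (PComp p q) => x /=; exists (pickle (g x)).
Qed.

Lemma cmp_pickle T U (f : T -> U) : cmp f -> cmp (fun x => pickle (f x)).
Proof. by []. Qed.

Lemma cmp_unpickle T U (f : T -> U) : cmp (fun x => pickle (f x)) -> cmp f.
Proof. by []. Qed.

Lemma cmp_pair T U V (f : T -> U) (g : T -> V) :
  cmp f -> cmp g -> cmp (fun x => (f x, g x)).
Proof.
move=> [p hp] [q hq]; exists (PPair p (PPair q PZero)) => x.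
rewrite pickle_pair /=; exists (pickle (f x)), (npair (pickle (g x)) 0).
by split=> //; exists (pickle (g x)), 0.
Qed.

Lemma cmp_comp2 W T U V (F : T -> U -> V) (a : W -> T) (b : W -> U) :
  cmp (fun p : T * U => F p.1 p.2) -> cmp a -> cmp b ->
  cmp (fun x => F (a x) (b x)).
Proof.
move=> hF ha hb.
exact: (cmp_comp (g := fun x => (a x, b x)) hF (cmp_pair ha hb)).
Qed.

Lemma cmp_fst T U V (f : T -> U * V) : cmp f -> cmp (fun x => (f x).1).
Proof.
move=> [p hp]; exists (PComp PLeft p) => x /=; exists (pickle (f x)) => //.
by case: (f x) => u v /=; rewrite pickle_pair nleftK.
Qed.

Lemma cmp_snd T U V (f : T -> U * V) : cmp f -> cmp (fun x => (f x).2).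
Proof.
move=> [p hp]; exists (PComp PLeft (PComp PRight p)) => x /=.
exists (nright (pickle (f x))); first by exists (pickle (f x)).
by case: (f x) => u v /=; rewrite pickle_pair nrightK nleftK.
Qed.

Lemma cmp_npair T (f g : T -> nat) :
  cmp f -> cmp g -> cmp (fun x => npair (f x) (g x)).
Proof.
move=> [p hp] [q hq]; exists (PPair p q) => x /=.
by exists (f x), (g x); split; [apply: hp | apply: hq |].
Qed.

Lemma cmp_nleft T (f : T -> nat) : cmp f -> cmp (fun x => nleft (f x)).
Proof. by move=> [p hp]; exists (PComp PLeft p) => x /=; exists (f x) => //; apply: hp. Qed.

Lemma cmp_nright T (f : T -> nat) : cmp f -> cmp (fun x => nright (f x)).
Proof. by move=> [p hp]; exists (PComp PRight p) => x /=; exists (f x) => //; apply: hp. Qed.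

Lemma cmp_succ T (f : T -> nat) : cmp f -> cmp (fun x => (f x).+1).
Proof. by move=> [p hp]; exists (PComp PSucc p) => x /=; exists (f x) => //; apply: hp. Qed.

Lemma cmp_nat_rect T U (z : T -> U) (F : T -> nat -> U -> U) (n : T -> nat) :
  cmp z -> cmp (fun p : T * (nat * U) => F p.1 p.2.1 p.2.2) -> cmp n ->
  cmp (fun x => nat_rect (fun _ => U) (z x) (F x) (n x)).
Proof.
move=> [pz hz] [pF hF] [pn hn].
(* [PRec] hands its step program [npair a (npair k u)], whereas the code of a nested pair has a
   terminating 0 at each level; [conv] inserts these zeros. *)
pose conv := PPair PLeft (PPair (PPair (PComp PLeft PRight)
  (PPair (PComp PRight PRight) PZero)) PZero).
exists (PComp (PRec pz (PComp pF conv)) (PPair PId pn)) => x.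
exists (npair (pickle x) (n x)).
  by exists (pickle x), (n x); split=> //; apply: hn.
rewrite /= nleftK nrightK; elim: (n x) => [|k IHk] //=.
set u := nat_rect _ _ _ _ in IHk *.
exists (pickle u) => //; exists (pickle (x, (k, u))); last exact: hF (x, (k, u)).
rewrite !pickle_pair; exists (pickle x), (npair (npair k (npair (pickle u) 0)) 0).
split=> //; first by rewrite nleftK.
exists (npair k (npair (pickle u) 0)), 0; split=> //.
exists k, (npair (pickle u) 0); split=> //.
  by exists (npair k (pickle u)); rewrite ?nrightK ?nleftK.
exists (pickle u), 0; split=> //.
by exists (npair k (pickle u)); rewrite ?nrightK ?nleftK.
Qed.

Lemma cmp_iter T U (z : T -> U) (F : T -> U -> U) (n : T -> nat) :
  cmp z -> cmp (fun p : T * U => F p.1 p.2) -> cmp n ->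
  cmp (fun x => iter (n x) (F x) (z x)).
Proof.
move=> hz hF hn.
apply: (@cmp_ext _ _ (fun x => nat_rect (fun _ => U) (z x) (fun _ => F x) (n x))).
  by move=> x; elim: (n x) => //= k ->.
apply: cmp_nat_rect => //.
have := cmp_comp (f := fun p : T * U => F p.1 p.2)
  (g := fun p : T * (nat * U) => (p.1, p.2.2)) hF.
by apply; apply: cmp_pair;
  [apply: cmp_fst; apply: cmp_id | apply: cmp_snd; apply: cmp_snd; apply: cmp_id].
Qed.

Lemma cmp_pred T (f : T -> nat) : cmp f -> cmp (fun x => (f x).-1).
Proof.
move=> hf; apply: (@cmp_ext _ _ (fun x => nat_rect (fun _ => nat) 0 (fun k _ => k) (f x))).
  by move=> x; case: (f x).
apply: (cmp_nat_rect (F := fun _ k _ => k)) => //; first exact: cmp_cst.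
by apply: cmp_fst; apply: cmp_snd; apply: cmp_id.
Qed.

Lemma cmp_if T U (b : T -> bool) (f g : T -> U) :
  cmp b -> cmp f -> cmp g -> cmp (fun x => if b x then f x else g x).
Proof.
move=> hb hf hg.
apply: (@cmp_ext _ _
  (fun x => nat_rect (fun _ => U) (g x) (fun _ _ => f x) (nat_of_bool (b x)))).
  by move=> x; case: (b x).
apply: (cmp_nat_rect (F := fun x _ _ => f x) hg) => //.
by apply: (cmp_comp hf); apply: cmp_fst; apply: cmp_id.
Qed.

Lemma cmp_andb T (b c : T -> bool) : cmp b -> cmp c -> cmp (fun x => b x && c x).
Proof. by move=> hb hc; apply: cmp_if => //; apply: cmp_cst. Qed.

Lemma cmp_orb T (b c : T -> bool) : cmp b -> cmp c -> cmp (fun x => b x || c x).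
Proof. by move=> hb hc; apply: cmp_if => //; apply: cmp_cst. Qed.

Lemma cmp_negb T (b : T -> bool) : cmp b -> cmp (fun x => ~~ b x).
Proof. by move=> hb; apply: cmp_if => //; apply: cmp_cst. Qed.

Lemma cmp_implb T (b c : T -> bool) : cmp b -> cmp c -> cmp (fun x => b x ==> c x).
Proof. by move=> hb hc; apply: cmp_if => //; apply: cmp_cst. Qed.

Lemma cmp_subn T (f g : T -> nat) : cmp f -> cmp g -> cmp (fun x => f x - g x).
Proof.
move=> hf hg; apply: (@cmp_ext _ _ (fun x => iter (g x) predn (f x))).
  by move=> x; elim: (g x) => [|k IHk] /=; rewrite ?subn0 // IHk subnS.
apply: (cmp_iter (F := fun _ => predn)) => //.
by apply: cmp_pred; apply: cmp_snd; apply: cmp_id.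
Qed.

Lemma cmp_eq0 T (f : T -> nat) : cmp f -> cmp (fun x => f x == 0).
Proof.
move=> hf; apply: (@cmp_ext _ _
  (fun x => nat_rect (fun _ => bool) true (fun _ _ => false) (f x))).
  by move=> x; case: (f x).
by apply: (cmp_nat_rect (F := fun _ _ _ => false)) => //; apply: cmp_cst.
Qed.

Lemma cmp_leq T (f g : T -> nat) : cmp f -> cmp g -> cmp (fun x => f x <= g x).
Proof. by move=> hf hg; apply: cmp_eq0; apply: cmp_subn. Qed.

Lemma cmp_eq T U (f g : T -> U) : cmp f -> cmp g -> cmp (fun x => f x == g x).
Proof.
move=> hf hg; apply: (@cmp_ext _ _
  (fun x => (pickle (f x) <= pickle (g x)) && (pickle (g x) <= pickle (f x)))).
  by move=> x; rewrite -eqn_leq (inj_eq (pcan_inj pickleK)).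
by apply: cmp_andb; apply: cmp_leq.
Qed.

Lemma cmp_maxn T (f g : T -> nat) :
  cmp f -> cmp g -> cmp (fun x => maxn (f x) (g x)).
Proof.
by move=> hf hg; apply: cmp_if => //; apply: cmp_leq => //; apply: cmp_succ.
Qed.

Lemma cmp_minn T (f g : T -> nat) :
  cmp f -> cmp g -> cmp (fun x => minn (f x) (g x)).
Proof.
by move=> hf hg; apply: cmp_if => //; apply: cmp_leq => //; apply: cmp_succ.
Qed.

Lemma cmp_search T (P : T -> nat -> bool) :
  cmp (fun p : T * nat => P p.1 p.2) -> (forall x, exists n, P x n) ->
  exists2 f : T -> nat, cmp f & forall x, P x (f x).
Proof.
move=> hP exP; exists (fun x => ex_minn (exP x)); last by move=> x; case: ex_minnP.
(* [PMu] looks for the value 0, which codes [false]; hence the program for the negation. *)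
have [p hp] := cmp_negb hP.
pose conv := PPair PLeft (PPair PRight PZero).
have ev x k : eval X (PComp p conv) (npair (pickle x) k) (~~ P x k).
  exists (pickle (x, k)); last exact: hp (x, k).
  rewrite pickle_pair; exists (pickle x), (npair k 0); split=> //=.
    by rewrite nleftK.
  by exists k, 0; split; rewrite ?nrightK.
exists (PMu (PComp p conv)) => x; case: ex_minnP => m Pm min_m; split.
  by have := ev x m; rewrite Pm.
move=> k lt_km; exists 0; have := ev x k.
by case: (boolP (P x k)) => // /min_m; rewrite leqNgt lt_km.
Qed.

Lemma cmp_cons T U (f : T -> U) (s : T -> seq U) :
  cmp f -> cmp s -> cmp (fun x => f x :: s x).
Proof.
move=> hf hs; apply: cmp_unpickle.
apply: (@cmp_ext _ _ (fun x => npair (pickle (f x)) (pickle (s x)))).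
  by move=> x; rewrite pickle_cons.
exact: cmp_npair.
Qed.

Lemma cmp_behead T U (s : T -> seq U) : cmp s -> cmp (fun x => behead (s x)).
Proof.
move=> hs; apply: cmp_unpickle.
apply: (@cmp_ext _ _ (fun x => nright (pickle (s x)))); last exact: cmp_nright.
by move=> x; case: (s x) => // u r; rewrite pickle_cons nrightK.
Qed.

Lemma cmp_nilp T U (s : T -> seq U) : cmp s -> cmp (fun x => nilp (s x)).
Proof.
move=> hs; apply: (@cmp_ext _ _ (fun x => pickle (s x) == 0)); last exact: cmp_eq0.
by move=> x; case: (s x) => // u r; rewrite pickle_cons eqn0Ngt npair_gt0.
Qed.

Lemma cmp_head T U (z : T -> U) (s : T -> seq U) :
  cmp z -> cmp s -> cmp (fun x => head (z x) (s x)).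
Proof.
move=> hz hs; apply: cmp_unpickle; apply: (@cmp_ext _ _
  (fun x => if nilp (s x) then pickle (z x) else nleft (pickle (s x)))).
  by move=> x; case: (s x) => // u r; rewrite pickle_cons nleftK.
by apply: cmp_if; [apply: cmp_nilp | | apply: cmp_nleft].
Qed.

Lemma cmp_foldl T U V (F : T -> U -> V -> U) (z : T -> U) (s : T -> seq V) :
  cmp (fun p : T * (U * V) => F p.1 p.2.1 p.2.2) -> cmp z -> cmp s ->
  cmp (fun x => foldl (F x) (z x) (s x)).
Proof.
(* The iteration below reads the list through [head], which needs a default value; if [V] is empty,
   all lists are empty and the fold is [z]. *)
move=> hF hz hs; have [[v0]|noV] := pselect (inhabited V); last first.
  apply: cmp_ext hz => x; case: (s x) => // v r.
  by case: noV; exists.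
(* Once the list is used up, [G] changes nothing, so iterating it too often is harmless. *)
pose G x (p : seq V * U) :=
  if nilp p.1 then p else (behead p.1, F x p.2 (head v0 p.1)).
apply: (@cmp_ext _ _ (fun x => (iter (pickle (s x)) (G x) (s x, z x)).2)).
  move=> x; move: (size_pickle (s x)); move: (pickle _) => n.
  elim: n (s x) (z x) => [|n IHn] [|v r] u //= ; rewrite -iterS iterSr /G /=.
    by move=> _; apply: (IHn [::]).
  by rewrite ltnS; apply: IHn.
apply: cmp_snd; apply: cmp_iter => //; first exact: cmp_pair.
have h2 : cmp (fun p : T * (seq V * U) => p.2) by apply: cmp_snd; apply: cmp_id.
apply: cmp_if => //; first by apply: cmp_nilp; apply: cmp_fst.
apply: cmp_pair; first by apply: cmp_behead; apply: cmp_fst.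
apply: (cmp_comp (g := fun p : T * (seq V * U) => (p.1, (p.2.2, head v0 p.2.1))) hF).
apply: cmp_pair; first by apply: cmp_fst; apply: cmp_id.
apply: cmp_pair; first exact: cmp_snd.
by apply: cmp_head; [apply: cmp_cst | apply: cmp_fst].
Qed.

Lemma cmp_rev T U (s : T -> seq U) : cmp s -> cmp (fun x => rev (s x)).
Proof.
move=> hs; apply: (@cmp_ext _ _ (fun x => foldl (fun r u => u :: r) [::] (s x))).
  move=> x; rewrite /rev; elim: (s x) [::] => //= u r IHr a; exact: IHr.
apply: (cmp_foldl (F := fun _ r u => u :: r)) => //; last exact: cmp_cst.
apply: cmp_cons; first by apply: cmp_snd; apply: cmp_snd; apply: cmp_id.
by apply: cmp_fst; apply: cmp_snd; apply: cmp_id.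
Qed.

Lemma cmp_foldr T U V (F : T -> V -> U -> U) (z : T -> U) (s : T -> seq V) :
  cmp (fun p : T * (V * U) => F p.1 p.2.1 p.2.2) -> cmp z -> cmp s ->
  cmp (fun x => foldr (F x) (z x) (s x)).
Proof.
move=> hF hz hs.
apply: (@cmp_ext _ _ (fun x => foldl (fun a y => F x y a) (z x) (rev (s x)))).
  by move=> x; rewrite -foldl_rev.
apply: (cmp_foldl (F := fun x a y => F x y a)) => //; last exact: cmp_rev.
apply: (cmp_comp (g := fun p : T * (U * V) => (p.1, (p.2.2, p.2.1))) hF).
have h2 : cmp (fun p : T * (U * V) => p.2) by apply: cmp_snd; apply: cmp_id.
apply: cmp_pair; first by apply: cmp_fst; apply: cmp_id.
by apply: cmp_pair; [apply: cmp_snd | apply: cmp_fst].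
Qed.

End Computable.

#[export] Hint Extern 0 (computable _ (fun x => x)) => exact: cmp_id : cmp.
#[export] Hint Extern 0 (computable _ (fun _ => ?c)) => exact: cmp_cst : cmp.
#[export] Hint Extern 1 (computable _ (fun x => pickle _)) => apply: cmp_pickle : cmp.
#[export] Hint Extern 1 (computable _ (fun x => (_, _))) => apply: cmp_pair : cmp.
#[export] Hint Extern 1 (computable _ (fun x => fst _)) => apply: cmp_fst : cmp.
#[export] Hint Extern 1 (computable _ (fun x => snd _)) => apply: cmp_snd : cmp.
#[export] Hint Extern 1 (computable _ (fun x => npair _ _)) => apply: cmp_npair : cmp.
#[export] Hint Extern 1 (computable _ (fun x => nleft _)) => apply: cmp_nleft : cmp.
#[export] Hint Extern 1 (computable _ (fun x => nright _)) => apply: cmp_nright : cmp.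
#[export] Hint Extern 1 (computable _ (fun x => S _)) => apply: cmp_succ : cmp.
#[export] Hint Extern 1 (computable _ (fun x => predn _)) => apply: cmp_pred : cmp.
#[export] Hint Extern 1 (computable _ (fun x => if _ then _ else _)) => apply: cmp_if : cmp.
#[export] Hint Extern 1 (computable _ (fun x => _ && _)) => apply: cmp_andb : cmp.
#[export] Hint Extern 1 (computable _ (fun x => _ || _)) => apply: cmp_orb : cmp.
#[export] Hint Extern 1 (computable _ (fun x => ~~ _)) => apply: cmp_negb : cmp.
#[export] Hint Extern 1 (computable _ (fun x => _ ==> _)) => apply: cmp_implb : cmp.
#[export] Hint Extern 1 (computable _ (fun x => _ - _)) => apply: cmp_subn : cmp.
#[export] Hint Extern 1 (computable _ (fun x => _ <= _)) => apply: cmp_leq : cmp.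
#[export] Hint Extern 1 (computable _ (fun x => _ == _)) => apply: cmp_eq : cmp.
#[export] Hint Extern 1 (computable _ (fun x => maxn _ _)) => apply: cmp_maxn : cmp.
#[export] Hint Extern 1 (computable _ (fun x => minn _ _)) => apply: cmp_minn : cmp.
#[export] Hint Extern 1 (computable _ (fun x => _ :: _)) => apply: cmp_cons : cmp.
#[export] Hint Extern 1 (computable _ (fun x => behead _)) => apply: cmp_behead : cmp.
#[export] Hint Extern 1 (computable _ (fun x => nilp _)) => apply: cmp_nilp : cmp.
#[export] Hint Extern 1 (computable _ (fun x => head _ _)) => apply: cmp_head : cmp.
#[export] Hint Extern 1 (computable _ (fun x => foldl _ _ _)) => apply: cmp_foldl : cmp.
#[export] Hint Extern 1 (computable _ (fun x => rev _)) => apply: cmp_rev : cmp.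
#[export] Hint Extern 1 (computable _ (fun x => foldr _ _ _)) => apply: cmp_foldr : cmp.
#[export] Hint Extern 1 (computable _ (fun x => nat_rect _ _ _ _)) => apply: cmp_nat_rect : cmp.
#[export] Hint Extern 1 (computable _ (fun x => iter _ _ _)) => apply: cmp_iter : cmp.
(* Unification may leave an eta-reduced function, which the patterns miss. *)
#[export] Hint Extern 5 (@computable ?X ?T ?U ?f) =>
  lazymatch f with
  | fun _ => _ => fail
  | _ => change (@computable X T U (fun x => f x))
  end : cmp.

Ltac cmp := solve [cbv beta zeta; auto 100 with cmp nocore].

Section MoreComputable.
Variable X : nat -> Prop.
Implicit Types T U V W : countType.

Local Notation cmp := (computable X).

Lemma cmp_map T U V (F : T -> U -> V) (s : T -> seq U) :
  cmp (fun p : T * U => F p.1 p.2) -> cmp s ->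
  cmp (fun x => [seq F x y | y <- s x]).
Proof.
move=> hF hs.
apply: (@cmp_ext _ _ _ (fun x => foldr (fun y r => F x y :: r) [::] (s x))).
  by move=> x; elim: (s x) => //= u r ->.
have hF' W b c := @cmp_comp2 X W _ _ _ F b c hF.
by apply: (cmp_foldr (F := fun x y r => F x y :: r)) => //; cmp.
Qed.

Lemma cmp_unzip1 T U V (s : T -> seq (U * V)) : cmp s -> cmp (fun x => unzip1 (s x)).
Proof.
move=> hs; apply: (@cmp_ext _ _ _ (fun x => [seq p.1 | p <- s x])) => //.
by apply: (cmp_map (F := fun _ p => p.1)) => //; cmp.
Qed.

Lemma cmp_unzip2 T U V (s : T -> seq (U * V)) : cmp s -> cmp (fun x => unzip2 (s x)).
Proof.
move=> hs; apply: (@cmp_ext _ _ _ (fun x => [seq p.2 | p <- s x])) => //.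
by apply: (cmp_map (F := fun _ p => p.2)) => //; cmp.
Qed.

Lemma cmp_all T U (a : T -> U -> bool) (s : T -> seq U) :
  cmp (fun p : T * U => a p.1 p.2) -> cmp s -> cmp (fun x => all (a x) (s x)).
Proof.
move=> ha hs.
apply: (@cmp_ext _ _ _ (fun x => foldr andb true (map (a x) (s x)))).
  by move=> x; elim: (s x) => //= u r ->.
have := cmp_map ha hs; cmp.
Qed.

Lemma cmp_has T U (a : T -> U -> bool) (s : T -> seq U) :
  cmp (fun p : T * U => a p.1 p.2) -> cmp s -> cmp (fun x => has (a x) (s x)).
Proof.
move=> ha hs.
apply: (@cmp_ext _ _ _ (fun x => foldr orb false (map (a x) (s x)))).
  by move=> x; elim: (s x) => //= u r ->.
have := cmp_map ha hs; cmp.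
Qed.

Lemma cmp_filter T U (a : T -> U -> bool) (s : T -> seq U) :
  cmp (fun p : T * U => a p.1 p.2) -> cmp s -> cmp (fun x => filter (a x) (s x)).
Proof.
move=> ha hs.
apply: (@cmp_ext _ _ _
  (fun x => foldr (fun y r => if a x y then y :: r else r) [::] (s x))).
  by move=> x; elim: (s x) => //= u r ->.
have ha' W b c := @cmp_comp2 X W _ _ _ a b c ha.
by apply: (cmp_foldr (F := fun x y r => if a x y then y :: r else r)) => //; cmp.
Qed.

Lemma cmp_cat T U (s r : T -> seq U) : cmp s -> cmp r -> cmp (fun x => s x ++ r x).
Proof.
move=> hs hr; apply: (@cmp_ext _ _ _ (fun x => foldr cons (r x) (s x))); last by cmp.
by move=> x; elim: (s x) => //= u t ->.
Qed.

Lemma cmp_rcons T U (s : T -> seq U) (f : T -> U) :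
  cmp s -> cmp f -> cmp (fun x => rcons (s x) (f x)).
Proof.
move=> hs hf; apply: (@cmp_ext _ _ _ (fun x => s x ++ [:: f x])).
  by move=> x; rewrite cats1.
by apply: cmp_cat; cmp.
Qed.

Lemma cmp_size T U (s : T -> seq U) : cmp s -> cmp (fun x => size (s x)).
Proof.
move=> hs; apply: (@cmp_ext _ _ _ (fun x => foldr (fun _ => succn) 0 (s x))); last by cmp.
by move=> x; elim: (s x) => //= u t ->.
Qed.

Lemma cmp_nth T U (z : T -> U) (s : T -> seq U) (n : T -> nat) :
  cmp z -> cmp s -> cmp n -> cmp (fun x => nth (z x) (s x) (n x)).
Proof.
move=> hz hs hn.
apply: (@cmp_ext _ _ _ (fun x => head (z x) (iter (n x) behead (s x)))); last by cmp.
move=> x; elim: (n x) (s x) => [|k IHk] s'; first by rewrite nth0.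
by rewrite iterSr IHk nth_behead.
Qed.

Lemma cmp_iota0 T (n : T -> nat) : cmp n -> cmp (fun x => iota 0 (n x)).
Proof.
move=> hn; apply: (@cmp_ext _ _ _
  (fun x => nat_rect (fun _ => seq nat) [::] (fun k r => rcons r k) (n x))).
  by move=> x; elim: (n x) => // k IHk; rewrite -addn1 iotaD cats1 /= addn1 /= IHk.
apply: (cmp_nat_rect (F := fun _ k r => rcons r k)); try cmp.
by apply: cmp_rcons; cmp.
Qed.

End MoreComputable.

#[export] Hint Extern 1 (computable _ (fun x => map _ _)) => apply: cmp_map : cmp.
#[export] Hint Extern 1 (computable _ (fun x => unzip1 _)) => apply: cmp_unzip1 : cmp.
#[export] Hint Extern 1 (computable _ (fun x => unzip2 _)) => apply: cmp_unzip2 : cmp.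
#[export] Hint Extern 1 (computable _ (fun x => all _ _)) => apply: cmp_all : cmp.
#[export] Hint Extern 1 (computable _ (fun x => has _ _)) => apply: cmp_has : cmp.
#[export] Hint Extern 1 (computable _ (fun x => filter _ _)) => apply: cmp_filter : cmp.
#[export] Hint Extern 1 (computable _ (fun x => _ ++ _)) => apply: cmp_cat : cmp.
#[export] Hint Extern 1 (computable _ (fun x => rcons _ _)) => apply: cmp_rcons : cmp.
#[export] Hint Extern 1 (computable _ (fun x => size _)) => apply: cmp_size : cmp.
#[export] Hint Extern 1 (computable _ (fun x => nth _ _ _)) => apply: cmp_nth : cmp.
#[export] Hint Extern 1 (computable _ (fun x => iota 0 _)) => apply: cmp_iota0 : cmp.

Section Decodable.
Variable X : nat -> Prop.
Implicit Types T U V W : countType.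

Local Notation cmp := (computable X).

Lemma cmp_zip T U V (u0 : U) (v0 : V) (s : T -> seq U) (r : T -> seq V) :
  cmp s -> cmp r -> cmp (fun x => zip (s x) (r x)).
Proof.
move=> hs hr; apply: (@cmp_ext _ _ _ (fun x =>
  [seq (nth u0 (s x) i, nth v0 (r x) i) | i <- iota 0 (minn (size (s x)) (size (r x)))])).
  move=> x; apply: (@eq_from_nth _ (u0, v0)).
    by rewrite size_map size_iota size_zip.
  move=> i; rewrite size_map size_iota => lti.
  by rewrite (nth_map 0) ?size_iota // nth_iota // add0n nth_zip_cond size_zip lti.
have hs' W a := @cmp_comp X W _ _ _ a hs.
have hr' W a := @cmp_comp X W _ _ _ a hr.
apply: (cmp_map (F := fun x i => (nth u0 (s x) i, nth v0 (r x) i))); last by cmp.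
by apply: cmp_pair; apply: cmp_nth; cmp.
Qed.

(** The programs search through numbers only. A total computable decoder turns such a search into
    one through [T]. *)
Definition decodable T : Prop := exists2 dec : nat -> T, cancel pickle dec & cmp dec.

Lemma decodable_nat : decodable nat.
Proof. by exists id => //; cmp. Qed.

Lemma decodable_pair T U : decodable T -> decodable U -> decodable (T * U)%type.
Proof.
move=> [dT dTK hT] [dU dUK hU].
exists (fun n => (dT (nleft n), dU (nleft (nright n)))).
  by case=> x y; rewrite pickle_pair nrightK !nleftK dTK dUK.
have hT' W a := @cmp_comp X W _ _ _ a hT.
have hU' W a := @cmp_comp X W _ _ _ a hU.
by cmp.
Qed.

Lemma decodable_seq T : decodable T -> decodable (seq T).
Proof.
move=> [dT dTK hT]; exists (fun n => map dT (CodeSeq.decode n)).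
  move=> s; rewrite CodeSeq.codeK -map_comp -[RHS]map_id.
  by apply: eq_map => x /=; apply: dTK.
have hdec : cmp CodeSeq.decode.
  apply: cmp_unpickle; apply: (@cmp_ext _ _ _ id); last by cmp.
  by move=> n; rewrite /= -[LHS]CodeSeq.decodeK /pickle /= /pickle_seq map_id_in.
have hT' W a := @cmp_comp X W _ _ _ a hT.
by apply: (cmp_map (F := fun _ => dT)) => //; cmp.
Qed.

(** The source of all effective choices below: if a witness exists for every input and witnesses can
    be recognized, searching through the codes finds one. *)
Lemma cmp_choice T U (P : T -> U -> bool) : decodable U ->
  cmp (fun p : T * U => P p.1 p.2) -> (forall x, exists u, P x u) ->
  exists2 f : T -> U, cmp f & forall x, P x (f x).
Proof.
move=> [dU dUK hU] hP exP.
have hP' W b c := @cmp_comp2 X W _ _ _ P b c hP.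
have hU' W a := @cmp_comp X W _ _ _ a hU.
have [||f hf Pf] := @cmp_search X T (fun x n => P x (dU n)).
- by cmp.
- by move=> x; have [u Pu] := exP x; exists (pickle u); rewrite dUK.
by exists (fun x => dU (f x)) => //; apply: (cmp_comp hU hf).
Qed.

Lemma cmp_oracle T U (f : T -> U) (S : U -> Prop) : X = coded S -> cmp f ->
  cmp (fun x => `[< S (f x) >]).
Proof.
move=> XE [p hp]; exists (PComp POracle p) => x /=; exists (pickle (f x)) => //.
have XS : X (pickle (f x)) <-> S (f x) by rewrite XE codedP.
by case: (asboolP (S (f x))) => h; [left | right]; rewrite XS.
Qed.

Lemma cmp_Phi T U (f : T -> U) : cmp f ->
  exists e, forall x, Phi X e (pickle x) (pickle (f x)).
Proof. by move=> [p hp]; exists (encode p) => x; exists p. Qed.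

(** With the empty oracle each query is answered by 0, so [PZero] can replace [POracle], and the
    result runs alike under any oracle. *)
Fixpoint unoracle (p : prog) : prog :=
  match p with
  | POracle => PZero
  | PPair f g => PPair (unoracle f) (unoracle g)
  | PComp f g => PComp (unoracle f) (unoracle g)
  | PRec f g => PRec (unoracle f) (unoracle g)
  | PMu f => PMu (unoracle f)
  | _ => p
  end.

Lemma eval_unoracle p n m : eval no_oracle p n m -> eval X (unoracle p) n m.
Proof.
elim: p n m => [|||||| f IHf g IHg | f IHf g IHg | f IHf g IHg | f IHf] n m //=.
- by case=> [[]|[_ ->]].
- by move=> [u [v [/IHf fu /IHg gv ->]]]; exists u, v.
- by move=> [u /IHg gu /IHf fu]; exists u.
- elim: (nright n) m => [|k IHk] m; first exact: IHf.
  by move=> [u /IHk hu /IHg gu]; exists u.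
- by move=> [/IHf f0 fS]; split=> // k /fS[v /IHf fv]; exists v.
Qed.

End Decodable.

(** * A decidable halting relation *)

(* A halting computation without oracle is certified by a list of entries
   (e, n, m), each asserting that the program coded by e maps n to m and being
   justified by the entries after it. *)
Definition entry : countType := (nat * nat * nat)%type.

(** An equation such as [e == npair 6 (npair f g)], with [f] and [g] projections of [e], both
    recognizes the constructor and ensures that the projections are its arguments. The clauses ask
    only for the presence of entries in [l], so they survive the enlargement of [l]. *)
Definition justified (l : seq entry) (q : entry) : bool :=
  let e := q.1.1 in let n := q.1.2 in let m := q.2 in
  let f := nleft (nright e) in let g := nright (nright e) in
  if e == npair 0 0 then m == 0 else
  if e == npair 1 0 then m == n.+1 else
  if e == npair 2 0 then m == n else
  if e == npair 3 0 then m == nleft n else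
  if e == npair 4 0 then m == nright n else
  if e == npair 5 0 then m == 0 else
  if e == npair 6 (npair f g) then
    has (fun u => (u.1 == (f, n)) &&
      has (fun v => (v.1 == (g, n)) && (m == npair u.2 v.2)) l) l else
  if e == npair 7 (npair f g) then
    has (fun u => (u.1 == (g, n)) && has (eq_op^~ (f, u.2, m)) l) l else
  if e == npair 8 (npair f g) then
    if nright n == 0 then has (eq_op^~ (f, nleft n, m)) l
    else has (fun u => (u.1 == (e, npair (nleft n) (nright n).-1)) &&
      has (eq_op^~ (g, npair (nleft n) (npair (nright n).-1 u.2), m)) l) l else
  if e == npair 9 (nright e) then
    has (eq_op^~ (nright e, npair n m, 0)) l &&
      all (fun k => has (fun u =>
        (u.1 == (nright e, npair n k)) && ~~ (u.2 == 0)) l) (iota 0 m)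
  else false.

(** The accumulator carries the suffix already read next to the verdict, so that the test is a plain
    fold and [cmp_foldr] applies. *)
Definition valid (l : seq entry) : bool :=
  (foldr (fun q p => (q :: p.1, justified p.1 q && p.2)) ([::], true) l).2.

Lemma cmp_valid X (T : countType) (s : T -> seq entry) :
  computable X s -> computable X (fun x => valid (s x)).
Proof.
move=> hs; apply: cmp_snd.
apply: (cmp_foldr (F := fun _ q (p : seq entry * bool) =>
  (q :: p.1, justified p.1 q && p.2))) => //; last by cmp.
apply: cmp_pair; first by cmp.
apply: cmp_andb; last by cmp.
rewrite /justified; cbv zeta.
do 6![apply: cmp_if; [by cmp | by cmp |]].
apply: cmp_if; first by cmp.
  apply: cmp_has; last by cmp.
  apply: cmp_andb; first by cmp.
  apply: cmp_has; last by cmp.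
  by cmp.
by cmp.
Qed.
#[export] Hint Extern 1 (computable _ (fun x => valid _)) => apply: cmp_valid : cmp.

Lemma valid_cons q l : valid (q :: l) = justified l q && valid l.
Proof.
rewrite /valid /=; congr (justified _ _ && _).
by elim: l => //= r l ->.
Qed.

Lemma has_sub (T : eqType) (a b : pred T) (s r : seq T) :
  {subset s <= r} -> (forall x, a x -> b x) -> has a s -> has b r.
Proof.
move=> sr ab /hasP[x xs ax]; apply/hasP.
by exists x; [apply: sr | apply: ab].
Qed.

Lemma justified_sub l l' q : {subset l <= l'} -> justified l q -> justified l' q.
Proof.
move=> ll'; rewrite /justified; do 6![case: ifP => // _].
do 2![case: ifP => _; first by
  apply: (has_sub ll') => u /andP[-> h] /=; apply: has_sub h].
case: ifP => _.
  case: ifP => _; first exact: has_sub.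
  by apply: (has_sub ll') => u /andP[-> h] /=; apply: has_sub h.
case: ifP => // _ /andP[h /allP h']; rewrite (has_sub ll' _ h) //=.
by apply/allP => k /h'; apply: has_sub.
Qed.

Lemma valid_cat l l' : valid l -> valid l' -> valid (l ++ l').
Proof.
move=> vl vl'; elim: l vl => //= q l IHl; rewrite !valid_cons => /andP[jq /IHl ->].
rewrite andbT; apply: justified_sub jq => x xl.
by rewrite mem_cat xl.
Qed.

Lemma npair_eq x y x' y' : (npair x y == npair x' y') = (x == x') && (y == y').
Proof. by apply/eqP/andP => [/npair_inj[-> ->]|[/eqP-> /eqP->]]. Qed.

Lemma justifiedE l p n m :
  justified l (encode p, n, m) =
  match p with
  | PZero | POracle => m == 0
  | PSucc => m == n.+1
  | PId => m == n
  | PLeft => m == nleft n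
  | PRight => m == nright n
  | PPair f g =>
      has (fun u => (u.1 == (encode f, n)) &&
        has (fun v => (v.1 == (encode g, n)) && (m == npair u.2 v.2)) l) l
  | PComp f g =>
      has (fun u => (u.1 == (encode g, n)) && has (eq_op^~ (encode f, u.2, m)) l) l
  | PRec f g =>
      if nright n == 0 then has (eq_op^~ (encode f, nleft n, m)) l
      else has (fun u => (u.1 == (encode p, npair (nleft n) (nright n).-1)) &&
        has (eq_op^~ (encode g, npair (nleft n) (npair (nright n).-1 u.2), m)) l) l
  | PMu f =>
      has (eq_op^~ (encode f, npair n m, 0)) l &&
      all (fun k => has (fun u =>
        (u.1 == (encode f, npair n k)) && ~~ (u.2 == 0)) l) (iota 0 m)
  end.
Proof.
by case: p => [|||||| f g | f g | f g | f];
  rewrite /justified /= ?(npair_eq, nrightK, nleftK) /= ?eqxx.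
Qed.

(** Induction on the list, not on the program: an entry appeals only to later ones, and an entry for
    [PRec] may appeal to the same program at a smaller counter. *)
Lemma valid_sound l p n m :
  valid l -> (encode p, n, m) \in l -> eval no_oracle p n m.
Proof.
elim: l p n m => // q l IHl p n m; rewrite valid_cons => /andP[jq /IHl{}IHl].
rewrite in_cons => /predU1P[def_q|]; last exact: IHl.
move: jq; rewrite -{}def_q justifiedE.
case: p => [|||||| f g | f g | f g | f]; try by move/eqP.
- by move/eqP; right; split; first case.
- case/hasP=> -[a u] ul /andP[/= /eqP def_a] /hasP[[b v] vl /andP[/= /eqP def_b /eqP->]].
  rewrite {}def_a in ul; rewrite {}def_b in vl.
  by exists u, v; split=> //; apply: IHl.
- case/hasP=> -[a u] ul /andP[/= /eqP def_a]; rewrite has_pred1 => ml.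
  by rewrite {}def_a in ul; exists u; apply: IHl.
- have IHr k v : (encode (PRec f g), npair (nleft n) k, v) \in l ->
    eval no_oracle (PRec f g) (npair (nleft n) k) v by apply: IHl.
  rewrite /=; case: (nright n) IHr => [|k] IHr; first by rewrite has_pred1 => /IHl.
  case/hasP=> -[a u] ul /andP[/= /eqP def_a]; rewrite has_pred1 => ml.
  rewrite {}def_a in ul; exists u; last exact: IHl.
  by have := IHr _ _ ul; rewrite /= nleftK nrightK.
- rewrite has_pred1 => /andP[/IHl f0 /allP h]; split=> // k lt_km.
  have /h/hasP[[a [|u]] ul /andP[/= /eqP def_a // _]] : k \in iota 0 m.
    by rewrite mem_iota.
  by rewrite {}def_a in ul; exists u; apply: IHl.
Qed.

Lemma valid_complete p n m :
  eval no_oracle p n m -> exists2 l, valid l & (encode p, n, m) \in l.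
Proof.
have extend p' n' m' l : valid l -> justified l (encode p', n', m') ->
    exists2 l', valid l' & (encode p', n', m') \in l'.
  by move=> vl jl; exists ((encode p', n', m') :: l); rewrite ?valid_cons ?mem_head ?jl.
elim: p n m => [|||||| f IHf g IHg | f IHf g IHg | f IHf g IHg | f IHf] n m;
  try by move=> h; apply: (extend _ _ _ [::]); rewrite ?justifiedE //; apply/eqP.
- by case=> [[[]]|[_ ->]]; apply: (extend _ _ _ [::]); rewrite ?justifiedE.
- case=> u [v [/IHf[l vl ul] /IHg[r vr ur] ->]].
  apply: (extend _ _ _ (l ++ r)); first exact: valid_cat.
  rewrite justifiedE; apply/hasP; exists (encode f, n, u); rewrite ?mem_cat ?ul ?eqxx //=.
  by apply/hasP; exists (encode g, n, v); rewrite ?mem_cat ?ur ?orbT ?eqxx.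
- case=> u /IHg[l vl ul] /IHf[r vr ur].
  apply: (extend _ _ _ (l ++ r)); first exact: valid_cat.
  rewrite justifiedE; apply/hasP; exists (encode g, n, u); rewrite ?mem_cat ?ul ?eqxx //=.
  by rewrite has_pred1 mem_cat ur orbT.
(* The inner recursion of [eval] sees only [nright n], while entries record whole inputs.
   Generalizing over all [n] with the given projections makes the induction hypothesis available at
   [npair a k]. *)
- move: (erefl (nleft n)) (erefl (nright n)); rewrite [eval _ _ _ _]/=.
  move: {2 3}(nright n) => k; move: {2 3 4}(nleft n) => a.
  elim: k n m => [|k IHk] n m def_a def_k.
    case/IHf=> l vl ml; apply: (extend _ _ _ l) => //.
    by rewrite justifiedE def_k def_a has_pred1.
  case=> u /(IHk (npair a k)); rewrite nleftK nrightK => -[]// l vl ul.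
  case/IHg=> r vr ur.
  apply: (extend _ _ _ (l ++ r)); first exact: valid_cat.
  rewrite justifiedE def_k def_a /=; apply/hasP.
  exists (encode (PRec f g), npair a k, u); rewrite ?mem_cat ?ul ?eqxx //=.
  by rewrite has_pred1 mem_cat ur orbT.
- case=> /IHf[l vl ml] h.
  have [r vr hr] : exists2 r, valid r & forall k, k < m ->
      has (fun u : entry => (u.1 == (encode f, npair n k)) && ~~ (u.2 == 0)) r.
    elim: {1 3}m (leqnn m) => [|j IHj] lejm; first by exists [::].
    have [r vr hr] := IHj (ltnW lejm).
    have [v /IHf[t vt ut]] := h j lejm.
    exists (r ++ t); first exact: valid_cat.
    move=> k; rewrite has_cat ltnS leq_eqVlt => /predU1P[->|/hr-> //].
    by apply/orP; right; apply/hasP; exists (encode f, npair n j, v.+1); rewrite /= ?eqxx.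
  apply: (extend _ _ _ (l ++ r)); first exact: valid_cat.
  rewrite justifiedE has_cat has_pred1 ml /=; apply/allP => k; rewrite mem_iota /= => /hr.
  by apply: has_sub => // u ur; rewrite mem_cat ur orbT.
Qed.

Definition certifies (l : seq entry) (e n m : nat) : bool :=
  valid l && has (eq_op^~ (e, n, m)) l.

Lemma cmp_certifies X (T : countType) (l : T -> seq entry) (e n m : T -> nat) :
  computable X l -> computable X e -> computable X n -> computable X m ->
  computable X (fun x => certifies (l x) (e x) (n x) (m x)).
Proof.
move=> hl he hn hm.
have he' W a := @cmp_comp X W _ _ _ a he.
have hn' W a := @cmp_comp X W _ _ _ a hn.
have hm' W a := @cmp_comp X W _ _ _ a hm.
by apply: cmp_andb; cmp.
Qed.
#[export] Hint Extern 1 (computable _ (fun x => certifies _ _ _ _)) => apply: cmp_certifies : cmp.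

(* The hypothesis on e is needed: if g is not a code, then neither is
   npair 8 (npair f g), but its entries for the base case can be justified. *)
Lemma Phi_certified e n m :
  (exists p, encode p = e) ->
  Phi no_oracle e n m <-> exists l, certifies l e n m.
Proof.
case=> p <-; split=> [[q /encode_inj->] /valid_complete[l vl nl]|[l]].
  by exists l; rewrite /certifies vl has_pred1.
by case/andP=> vl; rewrite has_pred1 => /(valid_sound vl) ?; exists p.
Qed.

(** * Terms, embeddings and atomic types *)

Section Structures.
Variable L : language.
Implicit Types A B C : structure L.

Lemma embedding_comp A B C (f : B -> C) (g : A -> B) :
  embedding f -> embedding g -> embedding (f \o g).
Proof.
have mapcomp n (t : n.-tuple A) :
    map_tuple (f \o g) t = map_tuple f (map_tuple g t).
  by apply: eq_from_tnth => i; rewrite !tnth_map.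
move=> [fI fR fF] [gI gR gF]; split=> [|R t|F t]; first exact: inj_comp.
  by rewrite mapcomp gR fR.
by rewrite mapcomp /= gF fF.
Qed.

Lemma embedding_inverse A B (f : A -> B) (g : B -> A) :
  embedding f -> cancel f g -> cancel g f -> embedding g.
Proof.
move=> [fI fR fF] fK gK.
have mapK n (t : n.-tuple B) : map_tuple f (map_tuple g t) = t.
  by apply: eq_from_tnth => i; rewrite !tnth_map gK.
split=> [|R t|F t]; first exact: can_inj gK.
  by rewrite fR mapK.
by apply: fI; rewrite fF mapK gK.
Qed.

Lemma isomorphism_inverse A B (f : A -> B) :
  isomorphism f -> exists2 g : B -> A, isomorphism g & cancel f g /\ cancel g f.
Proof.
case=> ef [g fK gK]; exists g => //; split; first exact: embedding_inverse gK.
by exists f.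
Qed.

Lemma isomorphic_sym A B : isomorphic A B -> isomorphic B A.
Proof. by case=> f /isomorphism_inverse[g ig _]; exists g. Qed.

Lemma isomorphic_trans A B C : isomorphic A B -> isomorphic B C -> isomorphic A C.
Proof.
move=> [f [ef bf]] [g [eg bg]]; exists (g \o f).
by split; [apply: embedding_comp | apply: bij_comp].
Qed.

Lemma sval_inj (T : Type) (S : T -> Prop) : injective (@sval T S).
Proof.
by case=> x Sx [y Sy] /= eq_xy; subst y; rewrite (Prop_irrelevance Sx Sy).
Qed.

Lemma embedding_sval A (S : A -> Prop) (cS : Defs.closed S) :
  embedding (sval : substructure cS -> A).
Proof. by split=> //; apply: sval_inj. Qed.

Lemma tval_embedding A B (f : A -> B) n (a : n.-tuple A) t :
  embedding f -> f (Defs.tval a t) = Defs.tval (map_tuple f a) t.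
Proof.
case=> _ _ fF; elim: t => [i|F ts IH] /=; first by rewrite tnth_map.
rewrite fF; congr (sfun B F _); apply: eq_from_tnth => i.
by rewrite tnth_map !tnth_mktuple IH.
Qed.

Lemma simeq_embedding A B (f : A -> B) n (a : n.-tuple A) :
  embedding f -> simeq a (map_tuple f a).
Proof.
move=> ef [t u|R ts] /=.
  by rewrite -!tval_embedding //; split=> [->//|]; case: ef => fI _ _; apply: fI.
case: (ef) => _ -> _.
rewrite (_ : map_tuple f _ = [tuple Defs.tval (map_tuple f a) (ts i) | i < rar R]) //.
by apply: eq_from_tnth => i; rewrite tnth_map !tnth_mktuple tval_embedding.
Qed.

Lemma simeq_sym A B n (a : n.-tuple A) (b : n.-tuple B) : simeq a b -> simeq b a.
Proof. by move=> ab phi; rewrite ab. Qed.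

Lemma simeq_trans A B C n (a : n.-tuple A) (b : n.-tuple B) (c : n.-tuple C) :
  simeq a b -> simeq b c -> simeq a c.
Proof. by move=> ab bc phi; rewrite ab bc. Qed.

Fixpoint rename m n (s : 'I_m -> 'I_n) (t : term L m) : term L n :=
  match t with
  | Var i => Var L (s i)
  | App F ts => App (fun i => rename s (ts i))
  end.

Lemma tval_rename A m n (s : 'I_m -> 'I_n) (a : n.-tuple A) t :
  Defs.tval a (rename s t) = Defs.tval [tuple tnth a (s i) | i < m] t.
Proof.
elim: t => [i|F ts IH] /=; first by rewrite tnth_mktuple.
by congr (sfun A F _); apply: eq_from_tnth => i; rewrite !tnth_mktuple IH.
Qed.

(** An atomic formula about the selected entries becomes, after renaming its variables, one about
    the full tuple; [s] may repeat or permute entries. *)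
Lemma simeq_rename A B m n (s : 'I_m -> 'I_n) (a : n.-tuple A) (b : n.-tuple B) :
  simeq a b -> simeq [tuple tnth a (s i) | i < m] [tuple tnth b (s i) | i < m].
Proof.
move=> ab [t u|R ts] /=.
  by rewrite -!tval_rename; apply: (ab (Equal (rename s t) (rename s u))).
have eqr C (c : n.-tuple C) : [tuple Defs.tval [tuple tnth c (s i) | i < m] (ts i) | i < rar R]
    = [tuple Defs.tval c (rename s (ts i)) | i < rar R].
  by apply: eq_from_tnth => i; rewrite !tnth_mktuple tval_rename.
rewrite !eqr; exact: (ab (Rel (fun i => rename s (ts i)))).
Qed.

Lemma cl_gen A n (a : n.-tuple A) i : cl a (tnth a i).
Proof. by move=> S _; apply. Qed.

(** The values of terms form a closed set containing [a]; closure under [F] chooses one term for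
    each argument. *)
Lemma clP A n (a : n.-tuple A) x : cl a x <-> exists t, Defs.tval a t = x.
Proof.
split=> [|[t <-]].
  move/(_ (fun y => exists t, Defs.tval a t = y)).
  apply=> [F t|i]; last by exists (Var L i).
  move=> /choice[ts hts]; exists (App ts) => /=.
  by congr (sfun A F _); apply: eq_from_tnth => i; rewrite tnth_mktuple.
elim: t => [i|F ts IH] /=; first exact: cl_gen.
by apply: cl_closed => i; rewrite tnth_mktuple.
Qed.

(** Choose a term for each element of [cl a] and evaluate it at [b]. The choice of the term does not
    matter, as equations between terms hold at [a] and at [b] alike. *)
Lemma simeq_isomorphism A B n (a : n.-tuple A) (b : n.-tuple B) : simeq a b ->
  exists2 f : clS a -> clS b, isomorphism f &
    forall i x, sval x = tnth a i -> sval (f x) = tnth b i.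
Proof.
move=> ab.
have /choice[trm htrm] : forall x : clS a, exists t, Defs.tval a t = sval x.
  by move=> x; apply/clP; apply: proj2_sig.
have /choice[trm' htrm'] : forall x : clS b, exists t, Defs.tval b t = sval x.
  by move=> x; apply/clP; apply: proj2_sig.
have teq t u : Defs.tval a t = Defs.tval a u <-> Defs.tval b t = Defs.tval b u.
  exact: (ab (Equal t u)).
have cla t : cl a (Defs.tval a t) by apply/clP; exists t.
have clb t : cl b (Defs.tval b t) by apply/clP; exists t.
pose f (x : clS a) : clS b := exist _ (Defs.tval b (trm x)) (clb _).
pose g (x : clS b) : clS a := exist _ (Defs.tval a (trm' x)) (cla _).
exists f; last by move=> i x xi; apply: (teq _ (Var L i)).1; rewrite htrm.
split; last first.
  exists g => x; apply: sval_inj => /=.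
    by rewrite -htrm; apply/teq; rewrite htrm'.
  by rewrite -htrm'; apply/teq; rewrite htrm.
split=> [x y|R t|F t].
- by move/(congr1 sval)/teq; rewrite !htrm => /sval_inj.
- have := ab (Rel (fun i => trm (tnth t i))) => /=.
  rewrite /= (_ : [tuple _ | _ < _] = map_tuple sval t); last first.
    by apply: eq_from_tnth => i; rewrite tnth_mktuple tnth_map htrm.
  move=> h; rewrite -[srel _ R t]/(srel A R (map_tuple sval t)) h.
  rewrite (_ : [tuple _ | _ < _] = map_tuple sval (map_tuple f t)) //.
  by apply: eq_from_tnth => i; rewrite tnth_mktuple !tnth_map.
- apply: sval_inj => /=; rewrite (teq _ (App (fun i => trm (tnth t i)))).1 /=.
    congr (sfun B F _); apply: eq_from_tnth => i.
    by rewrite tnth_mktuple !tnth_map.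
  rewrite htrm /=; congr (sfun A F _); apply: eq_from_tnth => i.
  by rewrite tnth_mktuple tnth_map htrm.
Qed.

Lemma simeq_extend A B n (a : n.-tuple A) (b : n.-tuple B) : simeq a b ->
  exists2 f : clS a -> B, embedding f &
    forall i x, sval x = tnth a i -> f x = tnth b i.
Proof.
case/simeq_isomorphism=> f [ef _] fi; exists (fun x => sval (f x)) => //.
exact: embedding_comp (embedding_sval _) ef.
Qed.

Lemma simeq_tnth A B n (a : n.-tuple A) (b : n.-tuple B) i j :
  simeq a b -> tnth a i = tnth a j <-> tnth b i = tnth b j.
Proof. by move=> ab; apply: (ab (Equal (Var L i) (Var L j))). Qed.

Lemma simeq_srel A B n (a : n.-tuple A) (b : n.-tuple B) R (s : 'I_(rar R) -> 'I_n) :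
  simeq a b ->
  srel A R [tuple tnth a (s i) | i < rar R] <-> srel B R [tuple tnth b (s i) | i < rar R].
Proof. by move=> ab; apply: (ab (Rel (fun i => Var L (s i)))). Qed.

Lemma simeq_sfun A B n (a : n.-tuple A) (b : n.-tuple B) F (s : 'I_(far F) -> 'I_n) j :
  simeq a b ->
  sfun A F [tuple tnth a (s i) | i < far F] = tnth a j <->
  sfun B F [tuple tnth b (s i) | i < far F] = tnth b j.
Proof. by move=> ab; apply: (ab (Equal (App (fun i => Var L (s i))) (Var L j))). Qed.

Lemma generates_isomorphic A n (a : n.-tuple A) : generates a -> isomorphic (clS a) A.
Proof.
move=> ga; exists sval; split; first exact: embedding_sval.
exists (fun x => exist _ x (ga x)) => // x.
exact: sval_inj.
Qed.

Lemma clS_fg A n (a : n.-tuple A) : finitely_generated (clS a).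
Proof.
exists n, [tuple exist _ (tnth a i) (cl_gen (a := a) i) : clS a | i < n].
move=> x; have /clP[t def_x] := proj2_sig x; apply/clP; exists t.
apply: sval_inj => /=; rewrite (tval_embedding _ _ (embedding_sval _)) /= -def_x.
congr (Defs.tval _ t); apply: eq_from_tnth => i.
by rewrite tnth_map tnth_mktuple.
Qed.

End Structures.

(** * Uniqueness of the structure with a given index *)

Section Index.
Variable L : language.

(** An index describes a structure through its domain and graphs only. Extensionality turns
    agreement of these into equality, so that structures with a common index can be substituted for
    each other. *)
Lemma eq_wstructure (M N : wstructure L) :
  dom M =1 dom N ->
  (forall p, rel_graph M p <-> rel_graph N p) ->
  (forall p, fun_graph M p <-> fun_graph N p) -> M = N.
Proof.
case: M N => [D [rM fM]] [E [rN fN]] /= /funext DE; subst E => rg fg.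
have nats_eq n (t u : n.-tuple {x | D x}) :
    [seq val x | x <- t] = [seq val x | x <- u] -> t = u.
  by move=> /(inj_map val_inj)/val_inj.
congr (WStructure (Interp _ _)).
  apply: functional_extensionality_dep => R; apply/funext => t; apply/propext.
  split=> h.
    have [|R' [t' [h' [/val_inj eqR]]]] := (rg (val R, [seq val x | x <- t])).1.
      by exists R, t.
    by subst R' => /nats_eq->.
  have [|R' [t' [h' [/val_inj eqR]]]] := (rg (val R, [seq val x | x <- t])).2.
    by exists R, t.
  by subst R' => /nats_eq->.
apply: functional_extensionality_dep => F; apply/funext => t.
have [|F' [t' [/val_inj eqF]]] :=
  (fg (val F, [seq val x | x <- t], val (fM F t))).1; first by exists F, t.
by subst F' => /nats_eq-> /val_inj.
Qed.

Lemma Phi_fun X e n m m' : Phi X e n m -> Phi X e n m' -> m = m'.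
Proof.
case=> p <- pm [q /encode_inj -> ].
elim: p n m m' pm => [|||||| f IHf g IHg | f IHf g IHg | f IHf g IHg | f IHf] n m m' /=;
  try by move=> -> ->.
- by case=> [[Xn ->]|[nXn ->]] [[Xn' ->]|[nXn' ->]].
- move=> [u [v [/IHf fu /IHg gv ->]]] [u' [v' [/fu -> /gv -> ->]]] //.
- by move=> [u /IHg gu /IHf fm] [u' /gu <- /fm].
- elim: (nright n) m m' => [|k IHk] m m'; first exact: IHf.
  by move=> [u /IHk gu /IHg gm] [u' /gu <- /gm].
- move=> [f0 fS] [f0' fS']; case: (ltngtP m m') => // lt.
    by have [v /(IHf _ _ _ f0)] := fS' _ lt.
  by have [v /(IHf _ _ _ f0')] := fS _ lt.
Qed.

Lemma enumerates_inj X e (T : countType) (S S' : T -> Prop) :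
  enumerates X e S -> enumerates X e S' -> forall x, S x <-> S' x.
Proof.
by move=> [_ hS] [_ hS'] x; rewrite -(codedP S) -(codedP S') hS hS'.
Qed.

Lemma structure_index_inj X e (M N : wstructure L) :
  structure_index X e M -> structure_index X e N -> M = N.
Proof.
move=> [eM [eR [eN [eF [-> dM rM _ fM]]]]].
move=> [eM' [eR' [eN' [eF' [eqe dN rN _ fN]]]]].
move: eqe => /(pcan_inj pickleK)[? ? ? ?]; subst eM' eR' eN' eF'.
apply: eq_wstructure.
- by move=> n; have := Phi_fun (dM n) (dN n); case: (dom M n); case: (dom N n).
- exact: enumerates_inj rM rN.
- exact: enumerates_inj fM fN.
Qed.
End Index.

(** * Atomic types of lists of codes and amalgamation *)

Definition sel (d J : seq nat) : seq nat := [seq nth 0 d j | j <- J].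

Section Codes.
Variable L : language.
Implicit Types M N P : wstructure L.

(* The relation of the paper's [simeq], between lists of codes of elements. *)
Definition sim M N (b c : seq nat) : Prop :=
  exists n (t : n.-tuple M) (u : n.-tuple N),
    [/\ nats t = b, nats u = c & simeq t u].

Lemma size_nats M n (t : n.-tuple M) : size (nats t) = n.
Proof. by rewrite size_map size_tuple. Qed.

Lemma nats_inj M n : injective (@nats L M n).
Proof. by move=> t u /(inj_map val_inj)/val_inj. Qed.

Lemma nth_nats M n (t : n.-tuple M) (i : 'I_n) :
  nth 0 (nats t) i = val (tnth t i : {x | dom M x}).
Proof. by rewrite (nth_map (tnth t i)) ?size_tuple // -tnth_nth. Qed.

Lemma dom_nats M n (t : n.-tuple M) : all (dom M) (nats t).
Proof. by apply/allP => x /mapP[y _ ->]; apply: valP. Qed.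

Lemma natsP M b : all (dom M) b -> exists t : (size b).-tuple M, nats t = b.
Proof.
move=> /allP bM.
have bi (i : 'I_(size b)) : dom M (nth 0 b i) by apply/bM/mem_nth.
exists [tuple exist _ (nth 0 b i) (bi i) : M | i < size b].
apply: (@eq_from_nth _ 0) => [|i]; rewrite size_nats // => ltib.
by rewrite (nth_nats _ (Ordinal ltib)) tnth_mktuple.
Qed.

Lemma natsPn M n b : all (dom M) b -> size b = n -> exists t : n.-tuple M, nats t = b.
Proof. by move=> db <-; apply: natsP. Qed.

Lemma sim_nats M N n (t : n.-tuple M) (u : n.-tuple N) :
  sim M N (nats t) (nats u) <-> simeq t u.
Proof.
split=> [[m [t' [u' [et eu]]]]|tu]; last by exists n, t, u.
have /eqP eq_mn := size_nats t'; rewrite et size_nats in eq_mn.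
by move/eqP: eq_mn => eq_mn; subst m; move: et eu => /nats_inj-> /nats_inj->.
Qed.

Lemma simP M N b n (t : n.-tuple N) :
  sim M N b (nats t) <-> exists2 u : n.-tuple M, nats u = b & simeq u t.
Proof.
split=> [[m [t' [u' [<- eu]]]]|[u <-]]; last by move/sim_nats.
have /eqP eq_mn := size_nats u'; rewrite eu size_nats in eq_mn.
by move/eqP: eq_mn => eq_mn; subst m; move: eu => /nats_inj->; exists t'.
Qed.

Lemma sim_size M N b c : sim M N b c -> size b = size c.
Proof. by case=> n [t [u [<- <- _]]]; rewrite !size_nats. Qed.

Lemma sim_doml M N b c : sim M N b c -> all (dom M) b.
Proof. by case=> n [t [u [<- _ _]]]; apply: dom_nats. Qed.

Lemma sim_domr M N b c : sim M N b c -> all (dom N) c.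
Proof. by case=> n [t [u [_ <- _]]]; apply: dom_nats. Qed.

Lemma sim_refl M b : all (dom M) b -> sim M M b b.
Proof. by move=> /natsP[t <-]; apply/sim_nats. Qed.

Lemma sim_sym M N b c : sim M N b c -> sim N M c b.
Proof. by case=> n [t [u [<- <- /simeq_sym ut]]]; apply/sim_nats. Qed.

Lemma sim_trans M N P b c d : sim M N b c -> sim N P c d -> sim M P b d.
Proof.
move=> bc [n [t [u [et <- tu]]]]; move: bc; rewrite -et => /simP[v <- vt].
by apply/sim_nats; apply: simeq_trans vt tu.
Qed.

Lemma nats_sel M n (t : n.-tuple M) J (ltJ : forall i : 'I_(size J), nth 0 J i < n) :
  nats [tuple tnth t (Ordinal (ltJ i)) | i < size J] = sel (nats t) J.
Proof.
apply: (@eq_from_nth _ 0) => [|i]; rewrite size_nats ?size_map // => lti.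
by rewrite (nth_nats _ (Ordinal lti)) tnth_mktuple (nth_map 0) //= -nth_nats.
Qed.

Lemma sim_sel M N b c J :
  sim M N b c -> all (gtn (size b)) J -> sim M N (sel b J) (sel c J).
Proof.
case=> n [t [u [<- <- tu]]] /allP; rewrite size_nats => ltJ.
have ltJ' (i : 'I_(size J)) : nth 0 J i < n by apply/ltJ/mem_nth.
rewrite -!(nats_sel _ ltJ'); apply/sim_nats.
exact: (simeq_rename (fun i => Ordinal (ltJ' i))).
Qed.

Lemma sim_nth M N b c i j : sim M N b c -> i < size b -> j < size b ->
  nth 0 b i = nth 0 b j <-> nth 0 c i = nth 0 c j.
Proof.
case=> n [t [u [<- <- tu]]]; rewrite size_nats => lti ltj.
rewrite !(nth_nats _ (Ordinal lti)) !(nth_nats _ (Ordinal ltj)).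
split=> /val_inj h; congr val; first by rewrite -(simeq_tnth _ _ tu).
by rewrite (simeq_tnth _ _ tu).
Qed.

Lemma sim_embedding M N (f : M -> N) n (t : n.-tuple M) :
  embedding f -> sim M N (nats t) (nats (map_tuple f t)).
Proof. by move=> ef; apply/sim_nats; apply: simeq_embedding. Qed.

Lemma sel_rcons b x J : all (gtn (size b)) J -> sel (rcons b x) J = sel b J.
Proof.
move/allP=> ltJ; apply/eq_in_map => j /ltJ /= ltj.
by rewrite nth_rcons ltj.
Qed.

End Codes.

Section Age.
Variables (L : language) (K : structure L -> Prop) (A : nat -> wstructure L).
Hypotheses (hK : is_age K) (hHP : HP K) (hJEP : JEP K) (hAP : AP K).
Hypotheses (KA : forall k, K (A k)) (AK : forall B, K B -> exists k, isomorphic B (A k)).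

(** Constants yield closed atomic formulas, so even the empty tuple has an atomic type. Embedding
    both structures into a common one shows that it is the same throughout the age. *)
Lemma sim_nil k l : sim (A k) (A l) [::] [::].
Proof.
have [C [KC [f ef] [g eg]]] := hJEP (KA k) (KA l).
exists 0, [tuple], [tuple]; split=> //.
apply: simeq_trans (simeq_embedding [tuple] ef) _.
rewrite [map_tuple _ _]tuple0 -[[tuple of [::]]](tuple0 (map_tuple g [tuple])).
exact/simeq_sym/simeq_embedding.
Qed.

(** The structure generated by the entries [J] of [d] is in the age by HP and embeds into [A k] by
    inclusion and into [A l] along the agreement of types. AP amalgamates the two; [d'] and [y] are
    the images of [d] and [x] in a member [A k'] isomorphic to the amalgam. *)
Lemma amalgamation k l d J b x :
  all (dom (A k)) d -> all (gtn (size d)) J ->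
  sim (A k) (A l) (sel d J) b -> dom (A l) x ->
  exists k' d' y, sim (A k) (A k') d d' /\
    sim (A k') (A l) (rcons (sel d' J) y) (rcons b x).
Proof.
move=> /natsP[t def_d] /allP ltJ [m [u [v [def_u def_b uv]]]] lx.
have [f ef fi] := simeq_extend uv.
have Kcl : K (clS u) by apply: hHP => //; apply: clS_fg.
have [D [KD [g [h [eg eh gh]]]]] := hAP Kcl (KA k) (KA l) (embedding_sval _) ef.
have [k' [i [ei _]]] := AK KD.
have eig := embedding_comp ei eg; have eih := embedding_comp ei eh.
pose d' := nats (map_tuple (i \o g) t).
have tuple_at' : sim (A k) (A k') d d' by rewrite -def_d; apply: sim_embedding.
have /natsP[w def_w] : all (dom (A l)) (rcons b x).
  by rewrite all_rcons lx -def_b dom_nats.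
exists k', d', (val (i (h (exist _ x lx)) : {y | dom (A k') y})); split=> //.
suff -> : rcons (sel d' J) (val (i (h (exist _ x lx)) : {y | dom (A k') y})) =
    nats (map_tuple (i \o h) w).
  by have := sim_embedding w eih; rewrite def_w => /sim_sym.
have sJ : size J = m by rewrite -(size_nats u) def_u size_map.
have sw : size (rcons b x) = m.+1 by rewrite size_rcons -def_b size_nats.
apply: (@eq_from_nth _ 0).
  by rewrite size_rcons size_nats size_map sJ sw.
move=> j; rewrite size_rcons size_map sJ ltnS nth_rcons size_map sJ => lejm.
have ltj : j < size (rcons b x) by rewrite sw.
rewrite (nth_nats _ (Ordinal ltj)) tnth_map.
have wj : val (tnth w (Ordinal ltj) : {y | dom (A l) y}) = nth 0 (rcons b x) j.
  by rewrite -[in RHS]def_w (nth_nats _ (Ordinal ltj)).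
case: ltngtP lejm => // [ltjm _|def_j _]; last first.
  congr (val (i (h _))); apply: val_inj.
  by rewrite wj nth_rcons def_j -def_b size_nats ltnn eqxx.
have ltjJ : nth 0 J j < size d by apply/ltJ/mem_nth; rewrite sJ.
rewrite (nth_map 0) ?sJ // /d' (nth_nats _ (Ordinal ltjJ)) tnth_map /=.
congr (val (i _)).
(* Entry [j] lies in the common substructure, on which the two maps into the amalgam agree. *)
pose z : clS u := exist _ (tnth u (Ordinal ltjm)) (cl_gen (a := u) _).
have -> : tnth t (Ordinal ltjJ) = sval z.
  apply: val_inj => /=; rewrite -!nth_nats /= def_u def_d.
  by rewrite (nth_map 0) ?sJ.
rewrite gh (fi (Ordinal ltjm)) //; congr h; apply: val_inj.
by rewrite wj nth_rcons -def_b size_nats ltjm (nth_nats _ (Ordinal ltjm)).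
Qed.

End Age.

(** * The limit of a chain of tuples *)

(* ne tells whether some A k is nonempty; if not, all the tuples d s are empty and
   so is the limit. *)
Section Chain.
Variables (L : language) (A C : nat -> wstructure L) (d : nat -> seq nat) (ne : bool).
Hypothesis hA : forall k x, dom (A k) x -> ne.
Hypothesis hC : forall s, exists k, C s = A k.
Hypothesis size_d : forall s, size (d s) = if ne then s.+1 else 0.
Hypothesis hcoh : forall s s', s <= s' -> sim (C s) (C s') (d s) (take (size (d s)) (d s')).
Hypothesis hext : forall s k J b x,
  all (gtn (size (d s))) J -> sim (C s) (A k) (sel (d s) J) b -> dom (A k) x ->
  exists s' e, [/\ s <= s', e < size (d s') &
    sim (C s') (A k) (rcons (sel (d s') J) (nth 0 (d s') e)) (rcons b x)].

(* The minimum keeps the index inside d s, so that pos s i is an element of C s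
   for all i when d s is nonempty. *)
Definition pos s i := nth 0 (d s) (minn i s).

(* Position i stands for the entry i of every d s with i <= s. *)
Definition eqp i j := pos (maxn i j) i == pos (maxn i j) j.

(* The least positions in the classes of eqp. *)
Definition mdom i := ne && all (fun j => ~~ eqp j i) (iota 0 i).

Lemma posE s i : i <= s -> pos s i = nth 0 (d s) i.
Proof. by move/minn_idPl => le_is; rewrite /pos le_is. Qed.

Lemma ltn_d s i : ne -> i <= s -> i < size (d s).
Proof. by move=> hne; rewrite size_d hne ltnS. Qed.

Lemma map_pos s J : all (geq s) J -> map (pos s) J = sel (d s) J.
Proof. by move/allP=> leJ; apply/eq_in_map => i /leJ; apply: posE. Qed.

Lemma sim_pos s s' J : ne -> all (geq s) J -> s <= s' ->
  sim (C s) (C s') (map (pos s) J) (map (pos s') J).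
Proof.
move=> hne leJ le_ss'.
have leJ' : all (geq s') J.
  by apply: sub_all leJ => i /= le_is; apply: leq_trans le_is le_ss'.
rewrite !map_pos //.
have -> : sel (d s') J = sel (take (size (d s)) (d s')) J.
  apply/eq_in_map => i /(allP leJ) /= le_is.
  by rewrite nth_take // size_d hne ltnS.
apply: sim_sel (hcoh le_ss') _.
by apply: sub_all leJ => i /=; apply: ltn_d.
Qed.

Lemma pos_eq s s' i j : ne -> i <= s -> j <= s -> s <= s' ->
  (pos s i == pos s j) = (pos s' i == pos s' j).
Proof.
move=> hne les lejs le_ss'.
have h : sim (C s) (C s') (map (pos s) [:: i; j]) (map (pos s') [:: i; j]).
  by apply: sim_pos => //=; rewrite les lejs.
by apply/eqP/eqP => /(sim_nth (i := 0) (j := 1) h); apply.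
Qed.

(** Equality of two entries belongs to the atomic type, which coherence preserves. One look at stage
    [maxn i j] therefore settles it for good, and this makes the domain of the limit decidable. *)
Lemma eqpE s i j : ne -> i <= s -> j <= s -> eqp i j = (pos s i == pos s j).
Proof.
by move=> hne le_is le_js; apply: pos_eq; rewrite ?leq_maxl ?leq_maxr // geq_max le_is.
Qed.

Lemma dom_pos s i : ne -> dom (C s) (pos s i).
Proof.
move=> hne; have /sim_doml/allP := hcoh (leqnn s); apply; apply: mem_nth.
by apply: ltn_d => //; apply: geq_minr.
Qed.

Lemma mdom_inj s i j : mdom i -> mdom j -> i <= s -> j <= s -> pos s i = pos s j -> i = j.
Proof.
wlog lt_ij : i j / i < j.
  move=> IH di dj le_is le_js eq_ij; case: (ltngtP i j) => // lt.
    exact: IH.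
  by apply/esym; apply: IH.
move=> /andP[hne _] /andP[_ /allP/(_ i)]; rewrite mem_iota lt_ij => /(_ isT) h le_is le_js eq_ij.
by rewrite (eqpE hne le_is le_js) eq_ij eqxx in h.
Qed.

Lemma mdom_repr i : ne -> exists j, [/\ mdom j, j <= i & forall s, i <= s -> pos s j = pos s i].
Proof.
move=> hne; elim/ltn_ind: i => i IH; case: (boolP (mdom i)) => [di|].
  by exists i.
rewrite {1}/mdom hne /= => /allPn[j]; rewrite mem_iota add0n => /= lt_ji /negbNE eq_ji.
have [k [dk le_kj hk]] := IH j lt_ji; exists k; split; first exact: dk.
  exact: leq_trans le_kj (ltnW lt_ji).
move=> s le_is; have le_js := leq_trans (ltnW lt_ji) le_is.
by rewrite hk //; apply/eqP; rewrite -eqpE.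
Qed.

Local Notation MT := {x : nat | mdom x}.

Lemma MT_ne (x : MT) : ne.
Proof. by case/andP: (valP x). Qed.

(** Total in order to be typed simply; for [val x > s] the value is just the last entry of [d s].
    The condition [before] excludes that case. *)
Definition emb s (x : MT) : C s := exist _ (pos s (val x)) (dom_pos s (val x) (MT_ne x)).
Arguments emb : simpl never.

Definition before s n (t : n.-tuple MT) := forall i, val (tnth t i) <= s.

Lemma nats_emb s n (t : n.-tuple MT) :
  nats (map_tuple (emb s) t) = map (pos s) (map val t).
Proof. by rewrite /nats -!map_comp. Qed.

Lemma beforeP s n (t : n.-tuple MT) : before s t <-> all (geq s) (map val t).
Proof.
split=> [h|/allP h i]; last by apply: h; apply: map_f; apply: mem_tnth.
by apply/allP => _ /mapP[x /tnthP[i ->] ->]; apply: h.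
Qed.

Lemma before_le s s' n (t : n.-tuple MT) : before s t -> s <= s' -> before s' t.
Proof. by move=> h le_ss' i; apply: leq_trans (h i) le_ss'. Qed.

Definition bound n (t : n.-tuple MT) := \max_(i < n) val (tnth t i).

Lemma bound_before n (t : n.-tuple MT) : before (bound t) t.
Proof. by move=> i; apply: leq_bigmax. Qed.

Lemma emb_simeq s s' n (t : n.-tuple MT) : before s t -> s <= s' ->
  simeq (map_tuple (emb s) t) (map_tuple (emb s') t).
Proof.
move=> ht le_ss'; case: (boolP ne) => hne.
  by apply/sim_nats; rewrite !nats_emb; apply: sim_pos => //; apply/beforeP.
(* If every [A k] is empty, only the empty tuple is left, and its type is preserved by coherence. *)
have n0 : n = 0 by case: n t {ht} => // n t; case/negP: hne; apply: MT_ne (tnth t ord0).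
subst n; apply/sim_nats; rewrite !nats_emb (tuple0 t) /=.
by apply: (sim_sel (J := [::]) (hcoh le_ss')).
Qed.

Lemma emb_inj s x y : val x <= s -> val y <= s -> emb s x = emb s y -> x = y.
Proof.
move=> le_xs le_ys /(congr1 val) eq_xy; apply: val_inj.
by apply: mdom_inj eq_xy => //; apply: valP.
Qed.

(** The value of [F] in [C s] need not be an entry of [d s]. The extension hypothesis, applied to
    [C s] itself and the positions [t], gives a later position [e] such that [t] followed by [e] has
    the type of the arguments followed by the value, and that type contains the equation for [F]. *)
Lemma mfun_exists (F : {m | Defs.fsym L m}) (t : (far F).-tuple MT) :
  exists y : MT, exists s,
    [/\ before s t, val y <= s & sfun (C s) F (map_tuple (emb s) t) = emb s y].
Proof.
pose s := bound t; have ht : before s t := bound_before t.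
pose x : {y | dom (C s) y} := sfun (C s) F (map_tuple (emb s) t).
(* Even for a constant and empty [t], the value [x] is an element of some [A k]. *)
have [k Ck] := hC s; have hne : ne by apply: (hA (k := k) (x := val x)); rewrite -Ck; apply: valP.
pose b := map val t.
have leb : all (geq s) b by apply/beforeP.
have ltb : all (gtn (size (d s))) b by apply: sub_all leb => i /=; apply: ltn_d.
have [||s' [e [le_ss' lte]]] := @hext s k b (sel (d s) b) (val x) ltb.
- rewrite -Ck; apply: sim_refl; rewrite -map_pos //; apply/allP => _ /mapP[i _ ->].
  exact: dom_pos.
- by rewrite -Ck; apply: valP.
rewrite -Ck => h.
have le_es' : e <= s' by move: lte; rewrite size_d hne ltnS.
have [y [dy le_ye hy]] := mdom_repr e hne.
have ht' := before_le ht le_ss'.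
exists (exist _ y dy), s'; split=> //; first exact: leq_trans le_ye le_es'.
pose u := rcons_tuple (map_tuple (emb s') t) (emb s' (exist _ y dy)).
pose v := rcons_tuple (map_tuple (emb s) t) (x : C s).
have : simeq u v.
  apply/sim_nats; rewrite /nats /= !map_rcons.
  rewrite -[map _ _]/(nats (map_tuple (emb s') t)).
  rewrite -[X in rcons X (val x)]/(nats (map_tuple (emb s) t)).
  rewrite !nats_emb !map_pos //; last by apply/beforeP.
  by rewrite -[sval _]/(pos s' y) hy ?posE.
have tn (T : Type) (w : (far F).-tuple T) z i :
    tnth (rcons_tuple w z) (widen_ord (leqnSn _) i) = tnth w i.
  by rewrite !(tnth_nth z) /= nth_rcons size_tuple ltn_ord.
have tl (T : Type) (w : (far F).-tuple T) z : tnth (rcons_tuple w z) ord_max = z.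
  by rewrite (tnth_nth z) /= nth_rcons size_tuple ltnn eqxx.
move=> /(simeq_sfun (F := F) (fun i => widen_ord (leqnSn _) i) ord_max).
have tt (T : Type) (w : (far F).-tuple T) z :
    [tuple tnth (rcons_tuple w z) (widen_ord (leqnSn _) i) | i < far F] = w.
  by apply: eq_from_tnth => i; rewrite tnth_mktuple tn.
by rewrite !tt !tl => -[_]; apply.
Qed.

(** A non-effective choice; [sfun_limit] shows that the value is determined by any stage at which it
    is visible, and effectiveness is recovered from [fun_graph_limit]. *)
Definition mfun F t : MT := projT1 (cid (mfun_exists (F := F) t)).

Definition limit : wstructure L :=
  @WStructure L mdom (Interp
    (fun R (t : (rar R).-tuple MT) => srel (C (bound t)) R (map_tuple (emb (bound t)) t))
    mfun).

Lemma srel_limit s R (t : (rar R).-tuple limit) : before s t ->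
  srel limit R t <-> srel (C s) R (map_tuple (emb s) t).
Proof.
move=> ht; have hb := bound_before t; have le_bs : bound t <= s.
  by apply/bigmax_leqP => i _; apply: ht.
have hst := emb_simeq hb le_bs.
have tt (T : Type) (w : (rar R).-tuple T) : [tuple tnth w i | i < rar R] = w.
  by apply: eq_from_tnth => i; rewrite tnth_mktuple.
by have := simeq_srel id hst; rewrite !tt.
Qed.

Lemma sfun_emb s s' F (t : (@far L F).-tuple MT) (y : MT) :
  before s t -> val y <= s -> s <= s' ->
  sfun (C s) F (map_tuple (emb s) t) = emb s y <->
  sfun (C s') F (map_tuple (emb s') t) = emb s' y.
Proof.
move=> ht le_ys le_ss'; pose u := rcons_tuple t y.
have hu : before s u.
  apply/beforeP; rewrite /= map_rcons all_rcons; apply/andP; split=> //.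
  exact/beforeP.
have := simeq_sfun (F := F) (fun i => widen_ord (leqnSn _) i) ord_max (emb_simeq hu le_ss').
have tn (T : Type) (f : MT -> T) :
    [tuple tnth (map_tuple f u) (widen_ord (leqnSn _) i) | i < far F] = map_tuple f t.
  apply: eq_from_tnth => i; rewrite tnth_mktuple !tnth_map; congr f.
  by rewrite !(tnth_nth y) /= nth_rcons size_tuple ltn_ord.
have tl : tnth u ord_max = y by rewrite (tnth_nth y) /= nth_rcons size_tuple ltnn eqxx.
by rewrite !tn !tnth_map tl.
Qed.

Lemma sfun_limit s F (t : (far F).-tuple limit) (y : limit) :
  before s t -> val (y : MT) <= s ->
  sfun limit F t = y <-> sfun (C s) F (map_tuple (emb s) t) = emb s y.
Proof.
move=> ht le_ys; rewrite -[sfun limit F t]/(mfun t) /mfun.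
case: cid => z [s' [ht' le_zs' hz]] /=.
have {hz} hz S : s' <= S -> sfun (C S) F (map_tuple (emb S) t) = emb S z.
  by move=> le; apply/(sfun_emb ht' le_zs' le).
(* The chosen value [z] is known at stage [s'] and the candidate [y] at stage [s]; they are compared
   at a common later stage. *)
have le1 := leq_maxl s s'; have le2 := leq_maxr s s'.
rewrite (sfun_emb ht le_ys le1) hz //; split=> [-> //|].
by apply: emb_inj; [apply: leq_trans le_zs' le2 | apply: leq_trans le_ys le1].
Qed.

(** Subterms may take values at positions far beyond those of [a], so [emb s] respects a given term
    only from some stage on, a maximum over its subterms. *)
Lemma tval_limit n (a : n.-tuple limit) t : exists S, forall s, S <= s ->
  val (Defs.tval a t : MT) <= s /\
  emb s (Defs.tval a t) = Defs.tval (map_tuple (emb s) a) t.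
Proof.
elim: t => [i|F ts /choice[S hS]] /=.
  exists (bound a) => s le_as; split; last by rewrite tnth_map.
  exact: leq_trans (bound_before a i) le_as.
set u := [tuple _ | _ < _]; set y := sfun limit F u.
exists (maxn (val (y : MT)) (\max_i S i)) => s.
rewrite geq_max => /andP[le_ys /bigmax_leqP leSs]; split=> //.
have hu : before s u by move=> i; rewrite tnth_mktuple; apply: (hS i s (leSs i isT)).1.
have /(sfun_limit hu le_ys) <- := erefl y.
congr (sfun (C s) F _); apply: eq_from_tnth => i; rewrite tnth_map !tnth_mktuple.
exact: (hS i s (leSs i isT)).2.
Qed.

(** For each atomic formula, move to a stage [S] where the values of all its terms are visible and
    [emb S] respects them. The type of the image of [a] is the same at [s] and at [S]. *)
Lemma simeq_limit s n (a : n.-tuple limit) : before s a ->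
  simeq a (map_tuple (emb s) a).
Proof.
move=> ha; have hsim S : s <= S -> simeq (map_tuple (emb s) a) (map_tuple (emb S) a).
  exact: emb_simeq.
case=> [t u|R ts].
  have [S1 h1] := tval_limit a t; have [S2 h2] := tval_limit a u.
  pose S := maxn s (maxn S1 S2).
  have leS : s <= S by apply: leq_maxl.
  have [h1S e1] : _ /\ _ := h1 S (leq_trans (leq_maxl _ _) (leq_maxr _ _)).
  have [h2S e2] : _ /\ _ := h2 S (leq_trans (leq_maxr _ _) (leq_maxr _ _)).
  rewrite (hsim S leS (Equal t u)) /= -e1 -e2; split=> [-> //|].
  exact: emb_inj.
have /choice[T hT] i := tval_limit a (ts i).
pose S := maxn s (\max_i T i).
have leS : s <= S by apply: leq_maxl.
have leT i : T i <= S by apply: leq_trans (leq_bigmax _) (leq_maxr _ _).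
rewrite (hsim S leS (Rel ts)) /=.
rewrite (@srel_limit S) => [|i]; last by rewrite tnth_mktuple; apply: (hT i S (leT i)).1.
rewrite (_ : map_tuple _ _ = [tuple Defs.tval (map_tuple (emb S) a) (ts i) | i < rar R]) //.
by apply: eq_from_tnth => i; rewrite tnth_map !tnth_mktuple (hT i S (leT i)).2.
Qed.

Lemma sim_limit s b : all mdom b -> all (geq s) b ->
  sim limit (C s) b (map (pos s) b).
Proof.
move=> /(natsP (M := limit))[t <-] /beforeP ht; rewrite -nats_emb.
by apply/sim_nats; apply: simeq_limit.
Qed.

Lemma sim_limit2 s b c : all (geq s) b -> all (geq s) c -> all mdom b -> all mdom c ->
  sim limit limit b c <-> sim (C s) (C s) (map (pos s) b) (map (pos s) c).
Proof.
move=> leb lec db dc; have hb := sim_limit db leb; have hc := sim_limit dc lec.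
split=> h; first exact: sim_trans (sim_trans (sim_sym hb) h) hc.
exact: sim_trans (sim_trans hb h) (sim_sym hc).
Qed.

Lemma all_geqW s s' b : s <= s' -> all (geq s) b -> all (geq s') b.
Proof. by move=> le_ss'; apply: sub_all => i /= le_is; apply: leq_trans le_is le_ss'. Qed.

Lemma all_geq_max b : all (geq (foldr maxn 0 b)) b.
Proof.
elim: b => //= i b IHb; rewrite leq_maxl /=.
by apply: all_geqW IHb; apply: leq_maxr.
Qed.

Lemma limit_extend k b c x : sim limit (A k) b c -> dom (A k) x ->
  exists2 y, mdom y & sim limit (A k) (rcons b y) (rcons c x).
Proof.
move=> bc kx; have hne := hA kx; have db := sim_doml bc.
pose s := foldr maxn 0 b; have leb : all (geq s) b := all_geq_max b.
have lt_b : all (gtn (size (d s))) b by apply: sub_all leb => i /=; apply: ltn_d.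
have bc' : sim (C s) (A k) (sel (d s) b) c.
  by rewrite -map_pos //; apply: sim_trans (sim_sym (sim_limit db leb)) bc.
have [s' [e [le_ss' lte h]]] := hext lt_b bc' kx.
have le_es' : e <= s' by move: lte; rewrite size_d hne ltnS.
have [y [dy le_ye hy]] := mdom_repr e hne; exists y => //.
have leb' := all_geqW le_ss' leb.
apply: sim_trans h; rewrite -map_pos // -posE // -hy // -map_rcons.
apply: sim_limit; rewrite all_rcons; apply/andP; split=> //.
exact: leq_trans le_ye le_es'.
Qed.

(** At a stage [s] where [b] and [x] are visible, [c] has the type of the image of [b] in [C s], a
    member of the age. Extending [c] by a partner of the image of [x] is then an instance of
    [limit_extend]. *)
Lemma limit_homogeneous b c x : sim limit limit b c -> mdom x ->
  exists2 y, mdom y & sim limit limit (rcons b x) (rcons c y).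
Proof.
move=> bc dx; pose s := foldr maxn 0 (x :: b).
have /= /andP[lex leb] : all (geq s) (x :: b) := all_geq_max (x :: b).
have db := sim_doml bc; have [k Ck] := hC s.
have hx : sim limit (C s) (rcons b x) (rcons (map (pos s) b) (pos s x)).
  rewrite -map_rcons; apply: sim_limit; rewrite all_rcons; apply/andP; split=> //.
have cb : sim limit (A k) c (map (pos s) b).
  by rewrite -Ck; apply: sim_trans (sim_sym bc) (sim_limit db leb).
have [|y dy h] := limit_extend cb (x := pos s x).
  by rewrite -Ck dom_pos //; case/andP: dx.
by exists y => //; apply: sim_trans hx _; rewrite Ck; apply: sim_sym.
Qed.

(** Realizes [c] one entry at a time. The hypothesis on empty tuples is the start, and JEP will
    supply it. *)
Lemma limit_universal k c : (forall l, sim (A l) (A k) [::] [::]) -> all (dom (A k)) c ->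
  exists b, sim limit (A k) b c.
Proof.
move=> h0; elim/last_ind: c => [|c x IHc].
  exists [::]; have [l Cl] := hC 0; apply: sim_trans (h0 l); rewrite -Cl.
  exact: (@sim_limit 0 [::]).
rewrite all_rcons => /andP[kx /IHc[b bc]].
by have [y _ h] := limit_extend bc kx; exists (rcons b y).
Qed.

(** The form needed for enumeration: a search over stages with a decidable side condition and a c.e.
    statement about one member of the age. *)
Lemma rel_graph_limit R t :
  rel_graph limit (R, t) <->
  exists s, [/\ all mdom t, all (geq s) t & rel_graph (C s) (R, map (pos s) t)].
Proof.
split=> [[R' [u [hu [-> ->]]]]|[s [dt le_t [R' [u [hu [-> def_u]]]]]]].
  exists (bound u); have hb := bound_before u.
  split; [exact: (dom_nats (M := limit)) | exact/beforeP |].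
  exists R', (map_tuple (emb (bound u)) u); split; first exact/srel_limit.
  by rewrite nats_emb.
have [|v def_v] := natsPn (M := limit) (n := rar R') dt.
  by rewrite -(size_map (pos s)) def_u size_nats.
exists R', v; rewrite def_v; split=> //.
have hv : before s v by apply/beforeP; rewrite -[map _ _]/(nats (M := limit) v) def_v.
apply/(srel_limit hv); rewrite (_ : map_tuple _ _ = u) //.
by apply: nats_inj; rewrite nats_emb -def_u -def_v.
Qed.

Lemma nrel_graph_limit R t :
  nrel_graph limit (R, t) <->
  exists s, [/\ all mdom t, all (geq s) t & nrel_graph (C s) (R, map (pos s) t)].
Proof.
split=> [[R' [u [hu [-> ->]]]]|[s [dt le_t [R' [u [hu [-> def_u]]]]]]].
  exists (bound u); have hb := bound_before u.
  split; [exact: (dom_nats (M := limit)) | exact/beforeP |].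
  exists R', (map_tuple (emb (bound u)) u); split.
    by move/(srel_limit hb).
  by rewrite nats_emb.
have [|v def_v] := natsPn (M := limit) (n := rar R') dt.
  by rewrite -(size_map (pos s)) def_u size_nats.
exists R', v; rewrite def_v; split=> //.
have hv : before s v by apply/beforeP; rewrite -[map _ _]/(nats (M := limit) v) def_v.
move/(srel_limit hv); rewrite (_ : map_tuple _ _ = u) //.
by apply: nats_inj; rewrite nats_emb -def_u -def_v.
Qed.

Lemma fun_graph_limit F t y :
  fun_graph limit (F, t, y) <->
  exists s, [/\ all mdom (y :: t), all (geq s) (y :: t) &
    fun_graph (C s) (F, map (pos s) t, pos s y)].
Proof.
split=> [[F' [u [-> -> ->]]]|[s [/= /andP[dy dt] /andP[le_y le_t] [F' [u [-> def_u def_y]]]]]].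
  set z := sfun limit F' u; pose s := maxn (bound u) (val (z : MT)).
  have hb : before s u := before_le (bound_before u) (leq_maxl _ _).
  have le_zs : val (z : MT) <= s := leq_maxr _ _.
  exists s; split.
  - by rewrite /=; apply/andP; split; [exact: (valP (z : MT)) | exact: (dom_nats (M := limit))].
  - by rewrite /=; apply/andP; split; last exact/beforeP.
  exists F', (map_tuple (emb s) u); rewrite nats_emb.
  by have /(sfun_limit hb le_zs) -> := erefl z.
have [|v def_v] := natsPn (M := limit) (n := far F') dt.
  by rewrite -(size_map (pos s)) def_u size_nats.
have hv : before s v by apply/beforeP; rewrite -[map _ _]/(nats (M := limit) v) def_v.
exists F', v; rewrite def_v; congr (_, _, _).
have le_y' : val (exist _ y dy : MT) <= s := le_y.
suff -> : sfun limit F' v = (exist _ y dy : MT) by [].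
apply/(sfun_limit hv le_y'); rewrite (_ : map_tuple _ _ = u).
  by apply: val_inj; apply/esym/def_y.
by apply: nats_inj; rewrite nats_emb -def_u -def_v.
Qed.
End Chain.

(** * Automorphisms from back-and-forth lists *)

Lemma isomorphism_simeq (L : language) (A : structure L) (h : A -> A) :
  bijective h -> (forall n (x : n.-tuple A), simeq x (map_tuple h x)) ->
  isomorphism h.
Proof.
move=> bh hx; split=> //; split=> [|R t|F t]; first exact: bij_inj.
  have := simeq_srel (R := R) id (hx _ t).
  rewrite (_ : [tuple tnth t _ | _ < _] = t); last first.
    by apply: eq_from_tnth => i; rewrite tnth_mktuple.
  rewrite (_ : [tuple tnth _ _ | _ < _] = map_tuple h t) //.
  by apply: eq_from_tnth => i; rewrite tnth_mktuple.
pose u := rcons_tuple t (sfun A F t).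
have tn (f : A -> A) :
    [tuple tnth (map_tuple f u) (widen_ord (leqnSn _) i) | i < far F] = map_tuple f t.
  apply: eq_from_tnth => i; rewrite tnth_mktuple !tnth_map; congr f.
  by rewrite !(tnth_nth (sfun A F t)) /= nth_rcons size_tuple ltn_ord.
have tl : tnth u ord_max = sfun A F t.
  by rewrite (tnth_nth (sfun A F t)) /= nth_rcons size_tuple ltnn eqxx.
have mapid n (w : n.-tuple A) : map_tuple id w = w by apply: eq_from_tnth => i; rewrite tnth_map.
have := simeq_sfun (F := F) (fun i => widen_ord (leqnSn _) i) ord_max (hx _ u).
rewrite -[in X in X <-> _](mapid _ u) !tn mapid !tnth_map tl => -[/(_ erefl)].
by [].
Qed.

Lemma extends_transfer_isomorphism (L : language) (A : structure L) (h : A -> A)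
    n (a b : n.-tuple A) :
  isomorphism h -> (forall i, h (tnth a i) = tnth b i) -> extends_transfer a b h.
Proof.
move=> ih hab; have [eh _] := ih.
have [g [eg _] [hK gK]] := isomorphism_inverse ih.
have hb : map_tuple h a = b by apply: eq_from_tnth => i; rewrite tnth_map.
have ga : map_tuple g b = a by apply: eq_from_tnth => i; rewrite tnth_map -hab hK.
have clh x : cl a x -> cl b (h x).
  by case/clP=> t <-; rewrite tval_embedding // hb; apply/clP; exists t.
have clg x : cl b x -> cl a (g x).
  by case/clP=> t <-; rewrite tval_embedding // ga; apply/clP; exists t.
pose f (x : clS a) : clS b := exist _ (h (sval x)) (clh _ (proj2_sig x)).
exists f => //; split; last by move=> i x /= ->.
have ft m (t : m.-tuple (clS a)) :
    map_tuple sval (map_tuple f t) = map_tuple h (map_tuple sval t).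
  by apply: eq_from_tnth => i; rewrite !tnth_map.
case: eh => hI hR hF; split; last first.
  by exists (fun y : clS b => exist _ (g (sval y)) (clg _ (proj2_sig y)) : clS a) => x;
    apply: sval_inj; rewrite /= ?hK ?gK.
split=> [x y /(congr1 sval) /hI/sval_inj //|R t|F t].
  by rewrite /srel /= ft; apply: hR.
by apply: sval_inj; rewrite /= ft; apply: hF.
Qed.

Definition lookup (z : seq (nat * nat)) (x : nat) : nat :=
  head 0 [seq p.2 | p <- z & p.1 == x].

Lemma lookupP z x : x \in unzip1 z -> (x, lookup z x) \in z.
Proof.
case/mapP=> -[x1 y1] xz /= ->; rewrite /lookup.
have : (x1, y1) \in [seq p <- z | p.1 == x1] by rewrite mem_filter eqxx.
case def_s: [seq p <- z | p.1 == x1] => [|[x2 y2] s] //= _.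
have : (x2, y2) \in [seq p <- z | p.1 == x1] by rewrite def_s mem_head.
by rewrite mem_filter /= => /andP[/eqP->].
Qed.

Section BackAndForth.
Variables (L : language) (M : wstructure L) (Z : nat -> seq (nat * nat)).
Hypothesis simZ : forall n, sim M M (unzip1 (Z n)) (unzip2 (Z n)).
Hypothesis subZ : forall n, {subset Z n <= Z n.+1}.
Hypothesis forthZ : forall x, dom M x -> x \in unzip1 (Z x.+1).
Hypothesis backZ : forall x, dom M x -> x \in unzip2 (Z x.+1).

Lemma subZ_le m n : m <= n -> {subset Z m <= Z n}.
Proof.
move=> le_mn; rewrite -(subnKC le_mn); elim: (n - m) => [|k IHk] p.
  by rewrite addn0.
by rewrite addnS => /IHk/subZ.
Qed.

(** Equality is atomic, so each [Z n] is the graph of an injective map and [lookup] has no real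
    choice to make. *)
Lemma Z_eq n p q : p \in Z n -> q \in Z n -> p.1 = q.1 <-> p.2 = q.2.
Proof.
move=> pZ qZ; have := sim_nth (i := index p (Z n)) (j := index q (Z n)) (simZ n).
rewrite size_map !index_mem => /(_ pZ qZ).
by rewrite !(nth_map (0, 0)) ?index_mem // !nth_index.
Qed.

Lemma Z_eq2 m n p q : p \in Z m -> q \in Z n -> p.1 = q.1 <-> p.2 = q.2.
Proof.
move=> pZ qZ; apply: (@Z_eq (maxn m n)).
  exact: subZ_le (leq_maxl _ _) _ pZ.
exact: subZ_le (leq_maxr _ _) _ qZ.
Qed.

Lemma Z_dom n p : p \in Z n -> dom M p.1 /\ dom M p.2.
Proof.
move=> pZ; split.
  by apply: (allP (sim_doml (simZ n))); apply: map_f.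
by apply: (allP (sim_domr (simZ n))); apply: map_f.
Qed.

Lemma back_and_forth : exists h : M -> M,
  [/\ forall x : {x | dom M x}, val (h x : {x | dom M x}) = lookup (Z (val x).+1) (val x),
      bijective h, isomorphism h &
      forall n (x y : {x | dom M x}), (val x, val y) \in Z n -> h x = y].
Proof.
have fZ (x : {x | dom M x}) : (val x, lookup (Z (val x).+1) (val x)) \in Z (val x).+1.
  by apply/lookupP/forthZ/valP.
pose h (x : {x | dom M x}) : {x | dom M x} :=
  exist (fun y => dom M y) (lookup (Z (val x).+1) (val x)) (Z_dom (fZ x)).2.
have hP n (x y : {x | dom M x}) : (val x, val y) \in Z n -> h x = y.
  by move=> xyZ; apply: val_inj; apply/(Z_eq2 (fZ x) xyZ).
have bh : bijective h.
  have /choice[g hg] (y : {x | dom M x}) : exists x : {x | dom M x}, h x = y.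
    have /mapP[[x y'] xyZ /= def_y] := backZ (valP y).
    have [dx _] := Z_dom xyZ; exists (exist _ x dx); apply: (hP (val y).+1).
    by move: xyZ; rewrite -def_y.
  exists g => // x; apply: val_inj; apply/(Z_eq2 (fZ (g (h x))) (fZ x)).
  exact: (congr1 val (hg (h x))).
exists h; split=> //; apply: isomorphism_simeq => // n t.
(* All pairs needed for [t] already occur in one list [Z N]; selecting their indices [J] on both
   sides transfers the agreement of types to [t] and its image. *)
apply/sim_nats; pose N := (\max_(x <- nats t) x).+1.
pose z := [seq (x, lookup (Z x.+1) x) | x <- nats t].
pose J := [seq index p (Z N) | p <- z].
have zZ p : p \in z -> p \in Z N.
  case/mapP=> x xt ->; apply: (@subZ_le x.+1); first exact: leq_bigmax_seq.
  by apply/lookupP/forthZ/(allP (dom_nats t)).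
have ltJ : all (gtn (size (unzip1 (Z N)))) J.
  by apply/allP => _ /mapP[p /zZ pZ ->]; rewrite /= size_map index_mem.
have := sim_sel (simZ N) ltJ; congr (sim M M _ _).
  rewrite /sel -map_comp /z -map_comp -[RHS]map_id; apply/eq_in_map => x xt /=.
  have /zZ xZ : (x, lookup (Z x.+1) x) \in z by apply/mapP; exists x.
  by rewrite (nth_map (0, 0)) ?index_mem // nth_index.
rewrite /sel -map_comp /z -map_comp /nats /= -!map_comp; apply/eq_in_map => x xt /=.
have /zZ xZ : (val x, lookup (Z (val x).+1) (val x)) \in z.
  by apply/mapP; exists (val x) => //; apply: map_f.
by rewrite (nth_map (0, 0)) ?index_mem // nth_index.
Qed.

End BackAndForth.

(** * The effective construction *)

Lemma enumerates_certified e (T : countType) (S : T -> Prop) :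
  enumerates no_oracle e S ->
  forall x, S x <-> exists w l, certifies l e w (pickle x).+1.
Proof.
(* Totality at stage 0 shows that [e] is the code of a program, as [Phi_certified] requires. *)
move=> [tot hS] x; have he : exists p, encode p = e.
  by have [m [p]] := tot 0; exists p.
rewrite -codedP hS; split=> [[w /(Phi_certified _ _ he)[l hl]]|[w [l hl]]].
  by exists w, l.
by exists w; apply/(Phi_certified _ _ he); exists l.
Qed.

(** Stage [n] decodes [n] into a pair and lists its first component if the second is a witness for
    it. *)
Lemma ce_projection X (T W : countType) (S : T -> Prop) (P : T -> W -> bool) :
  decodable X T -> decodable X W -> computable X (fun p : T * W => P p.1 p.2) ->
  (forall t, S t <-> exists w, P t w) -> ce X S.
Proof.
move=> dT dW hP hS; have [dec decK hdec] := decodable_pair dT dW.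
have hP' V b c := @cmp_comp2 X V _ _ _ P b c hP.
have hd V a := @cmp_comp X V _ _ _ a hdec.
pose f n := if P (dec n).1 (dec n).2 then (pickle (dec n).1).+1 else 0.
have hf : computable X f by rewrite /f; cmp.
have [e he] := cmp_Phi hf; exists e; split=> [s|n]; first by exists (f s); apply: he.
split=> [[t /hS[w Ptw] <-]|[s hs]].
  by exists (pickle (t, w)); have := he (pickle (t, w)); rewrite /f decK /= Ptw.
have := Phi_fun hs (he s); rewrite /f; case: ifP => // Pd [->].
by exists (dec s).1 => //; apply/hS; exists (dec s).2.
Qed.

Lemma cmp_encode_const X (T : countType) (f : T -> nat) :
  computable X f -> computable X (fun x => encode (const_prog (f x))).
Proof.
move=> hf; apply: (@cmp_ext _ _ _ (fun x => nat_rect (fun _ => nat) (encode PZero)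
  (fun _ c => npair 7 (npair (encode PSucc) c)) (f x))).
  by move=> x; elim: (f x) => //= n ->.
by apply: (cmp_nat_rect (F := fun _ _ c => npair 7 (npair (encode PSucc) c))) => //; cmp.
Qed.

#[export] Hint Extern 1 (computable _ (fun x => encode (const_prog _))) =>
  apply: cmp_encode_const : cmp.

(** The parameter theorem: ultrahomogeneity asks for indices of automorphisms, so the parameter is
    built into the program as a constant. *)
Lemma smn X (T : countType) (f : T -> nat -> nat) :
  computable X (fun p : T * nat => f p.1 p.2) ->
  exists2 v : T -> nat, computable X v & forall t n, Phi X (v t) n (f t n).
Proof.
move=> [p hp]; pose q (t : T) := PComp p (PPair (const_prog (pickle t)) (PPair PId PZero)).
exists (fun t => encode (q t)) => /=; first by cmp.
move=> t n; exists (q t) => //=; exists (pickle (t, n)); last exact: hp (t, n).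
rewrite pickle_pair; exists (pickle t), (npair n 0); split=> //.
  exact: eval_const.
by exists n, 0.
Qed.

Lemma cmp_sel X (T : countType) (b J : T -> seq nat) :
  computable X b -> computable X J -> computable X (fun x => sel (b x) (J x)).
Proof.
move=> hb hJ; have hb' V a := @cmp_comp X V _ _ _ a hb.
by rewrite /sel; cmp.
Qed.

Section Construction.
Variables (L : language) (K : structure L -> Prop) (KK : triple -> Prop).
Hypotheses (hK : is_age K) (hKK : computable_age KK K).
Hypotheses (hHP : HP K) (hJEP : JEP K) (hAP : AP K).

Local Notation X := (coded (EI L KK)).
Local Notation cmp := (computable X).

(** Run the enumeration of [KK] until a triple with last component [k] appears. *)
Lemma computable_representation :
  exists2 ag : nat -> seq nat * nat, cmp ag & forall k, KK (ag k, k).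
Proof.
have [[e [tot he]] ex1 _ _] := hKK.
have /choice[en hen] := tot.
have [m [p def_e _]] := tot 0.
have hcen : cmp en.
  exists (unoracle p) => s; apply: eval_unoracle.
  by have [q /esym] := hen s; rewrite -def_e => /encode_inj ->.
have hcen' V a := @cmp_comp X V _ _ _ a hcen.
have henP t : KK t <-> exists s, en s = (pickle t).+1.
  rewrite -codedP he; split=> [[s hs]|[s hs]]; exists s; last by rewrite -hs.
  exact: Phi_fun (hen s) hs.
have dU : decodable X (seq nat * nat * nat)%type.
  apply: decodable_pair (decodable_nat X); apply: decodable_pair (decodable_nat X).
  exact/decodable_seq/decodable_nat.
pose P (k : nat) (u : seq nat * nat * nat) := en u.2 == (pickle (u.1, k)).+1.
have cP : cmp (fun p : nat * (seq nat * nat * nat) => P p.1 p.2).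
  by rewrite /P; cmp.
have exP k : exists u, P k u.
  have [ae [/henP[s hs] _]] := ex1 k.
  by exists (ae, s); apply/eqP.
have [f hf fP] := cmp_choice dU cP exP.
exists (fun k => (f k).1); first exact: cmp_fst.
by move=> k; apply/henP; exists (f k).2; apply/eqP/fP.
Qed.

Variable ag : nat -> seq nat * nat.
Hypotheses (cmp_ag : cmp ag) (hag : forall k, KK (ag k, k)).
Variable A : nat -> wstructure L.
Hypothesis hA : forall k, [/\ structure_index no_oracle (ag k).2 (A k), K (A k) &
  exists n (t : n.-tuple (A k)), nats t = (ag k).1 /\ generates t].

Lemma ag_unique k ae : KK (ae, k) -> ae = ag k.
Proof.
have [_ ex1 _ _] := hKK; have [ae' [_ uniq]] := ex1 k.
by move/uniq => <-; apply: uniq.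
Qed.

Lemma KA k : K (A k).
Proof. by have [] := hA k. Qed.

Lemma AK B : K B -> exists k, isomorphic B (A k).
Proof.
have [_ _ _ h] := hKK; move=> /h[a [e [i [A' [kk iA' BA']]]]].
exists i; have [iA _ _] := hA i.
by rewrite (structure_index_inj iA (N := A')) // -(ag_unique kk).
Qed.

Definition simb k b l c : bool := `[< EI L KK ((ag k, k), b, (ag l, l), c) >].

(** [EI] speaks of arbitrary structures with the given indices; as an index determines its
    structure, these are [A k] and [A l]. *)
Lemma simbP k b l c : reflect (sim (A k) (A l) b c) (simb k b l c).
Proof.
apply: (iffP idP) => [/asboolP|].
  move=> [a0 [a1 [e0 [e1 [k0 [k1 [A0 [A1 [n [b0 [b1 [[kk0 i0] [kk1 i1] b01]]]]]]]]]]]].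
  move=> [e0' ek0 -> e1' ek1 ->]; subst k0 k1.
  have [iA0 _ _] := hA k; have [iA1 _ _] := hA l.
  rewrite e0' /= in iA0; rewrite e1' /= in iA1.
  have eA0 := structure_index_inj iA0 i0; have eA1 := structure_index_inj iA1 i1.
  by subst A0 A1; apply/sim_nats.
move=> [n [t [u [<- <- tu]]]]; apply/asboolP.
exists (ag k).1, (ag l).1, (ag k).2, (ag l).2, k, l, (A k), (A l), n, t, u.
have [iA0 _ _] := hA k; have [iA1 _ _] := hA l.
split=> //; last by case: (ag k); case: (ag l).
  by split=> //; case: (ag k) (hag k).
by split=> //; case: (ag l) (hag l).
Qed.

Lemma cmp_simb (T : countType) (k l : T -> nat) (b c : T -> seq nat) :
  cmp k -> cmp b -> cmp l -> cmp c -> cmp (fun x => simb (k x) (b x) (l x) (c x)).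
Proof.
move=> hk hb hl hc; have hag' V a := @cmp_comp X V _ _ _ a cmp_ag.
apply: (cmp_oracle (f := fun x => ((ag (k x), k x), b x, (ag (l x), l x), c x)) erefl).
by cmp.
Qed.

(** Comparing a tuple with itself tests membership; this is how [feasible] checks the state and the
    new element [x]. *)
Lemma simb_dom k b : simb k b k b = all (dom (A k)) b.
Proof. by apply/simbP/idP => [/sim_doml|/sim_refl]. Qed.

(* A task (J, l, b, x) asks for a position e such that, if the positions J
   realize the atomic type of b in A l, then J followed by e realizes that of b
   followed by x.  A state (k, d) is the tuple d in A k. *)
Definition task : countType := (seq nat * nat * seq nat * nat)%type.
Definition state : countType := (nat * seq nat)%type.

Definition feasible (p : state * task) : bool :=
  [&& simb p.1.1 p.1.2 p.1.1 p.1.2, all (fun j => j < size p.1.2) p.2.1.1.1,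
      simb p.1.1 (sel p.1.2 p.2.1.1.1) p.2.1.1.2 p.2.1.2 &
      simb p.2.1.1.2 [:: p.2.2] p.2.1.1.2 [:: p.2.2]].

Definition solves (p : state * task) (w : nat * seq nat * nat) : bool :=
  simb p.1.1 p.1.2 w.1.1 w.1.2 &&
  simb w.1.1 (rcons (sel w.1.2 p.2.1.1.1) w.2) p.2.1.1.2 (rcons p.2.1.2 p.2.2).

#[local] Hint Extern 1 (computable _ (fun x => simb _ _ _ _)) => apply: cmp_simb : cmp.
#[local] Hint Extern 1 (computable _ (fun x => sel _ _)) => apply: cmp_sel : cmp.

Lemma cmp_feasible : cmp feasible.
Proof. by rewrite /feasible; cmp. Qed.

Lemma computable_amalgamation :
  exists2 am : state * task -> nat * seq nat * nat, cmp am &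
    forall p, feasible p -> solves p (am p).
Proof.
have dU : decodable X (nat * seq nat * nat)%type.
  apply: decodable_pair (decodable_nat X); apply: decodable_pair (decodable_nat X) _.
  exact/decodable_seq/decodable_nat.
have hf V a := @cmp_comp X V _ _ _ a cmp_feasible.
(* The implication makes the search succeed at once on infeasible inputs, so that [am] is total. *)
pose P p w := feasible p ==> solves p w.
have cP : cmp (fun p : (state * task) * (nat * seq nat * nat) => P p.1 p.2).
  by rewrite /P; apply: cmp_implb; first cmp; rewrite /solves; cmp.
have exP p : exists w, P p w.
  rewrite /P; case: p => -[k d] [[[J l] b] x].
  case: (boolP (feasible _)); last by exists (0, [::], 0).
  case/and4P=> /=; rewrite !simb_dom /= andbT => kd ltJ /simbP h lx.
  have [k' [d' [y [tuple_at' h']]]] := amalgamation hHP hAP KA AK kd ltJ h lx.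
  by exists (k', d', y); apply/andP; split; apply/simbP.
have [am ham amP] := cmp_choice dU cP exP.
by exists am => // p fp; have := amP p; rewrite /P fp.
Qed.

(** * The computable chain of tuples *)

Variable am : state * task -> nat * seq nat * nat.
Hypotheses (cmp_am : cmp am) (amP : forall p, feasible p -> solves p (am p)).
Variable dt : nat -> task.
Hypotheses (dtK : cancel pickle dt) (cmp_dt : cmp dt).
Variables (ne : bool) (init : state).
Hypothesis hne : forall k x, dom (A k) x -> ne.
Hypothesis hinit : all (dom (A init.1)) init.2 /\ size init.2 = ne.

(* If the task cannot be carried out, an entry is repeated, so that after s steps
   the tuple has s + 1 entries whenever it is nonempty. *)
Definition step (p : state * task) : state :=
  if feasible p then ((am p).1.1, rcons (am p).1.2 (am p).2)
  else if nilp p.1.2 then p.1 else (p.1.1, rcons p.1.2 (head 0 p.1.2)).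

(* Every task is attempted at arbitrarily late stages, since nleft takes each
   value infinitely often. *)
Definition chain (s : nat) : state :=
  nat_rect (fun _ => state) init (fun s st => step (st, dt (nleft s))) s.

Local Notation C s := (A (chain s).1).
Local Notation d s := (chain s).2.

Lemma cmp_chain : cmp chain.
Proof.
have hf V a := @cmp_comp X V _ _ _ a cmp_feasible.
have hm V a := @cmp_comp X V _ _ _ a cmp_am.
have hd V a := @cmp_comp X V _ _ _ a cmp_dt.
rewrite /chain; apply: (cmp_nat_rect (F := fun _ s st => step (st, dt (nleft s)))); try cmp.
by rewrite /step; cmp.
Qed.

Lemma size_step p : (0 < size p.1.2) = ne -> size (step p).2 = size p.1.2 + ne.
Proof.
move=> hs; rewrite /step; case: ifP => [fp|_].
  have /andP[/simbP/sim_size eq_size _] := amP fp.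
  have /and4P[_ _ _ hx] := fp; rewrite simb_dom /= andbT in hx.
  by rewrite size_rcons eq_size (hne hx) addn1.
case def_d: p.1.2 hs => [|x r] <- /=; first by rewrite def_d.
by rewrite size_rcons addn1.
Qed.

Lemma step_coherent p : all (dom (A p.1.1)) p.1.2 ->
  all (dom (A (step p).1)) (step p).2 /\
  sim (A p.1.1) (A (step p).1) p.1.2 (take (size p.1.2) (step p).2).
Proof.
move=> hp; rewrite /step; case: ifP => [fp|_].
  have /andP[/simbP h1 /simbP h2] := amP fp.
  have := sim_doml h2; rewrite !all_rcons => /andP[-> _] /=.
  rewrite (sim_domr h1); split=> //.
  by rewrite (sim_size h1) -cats1 take_size_cat.
case: nilP => [d0|]; first by rewrite take_size; split=> //; apply: sim_refl.
case: p hp => -[k [|x r]] t //= /andP[kx kr] _.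
rewrite kx all_rcons kx kr -cats1 take_size_cat //; split=> //.
by apply: sim_refl; rewrite /= kx.
Qed.

Lemma size_chain s : size (d s) = if ne then s.+1 else 0.
Proof.
have [_ hi] := hinit; elim: s => [|s IHs]; first by rewrite hi; case: ne.
rewrite size_step /=; last by rewrite IHs; case: ne.
by rewrite IHs; case: ne; rewrite ?addn1.
Qed.

Lemma chain_dom s : all (dom (A (chain s).1)) (d s).
Proof.
elim: s => [|s IHs]; first exact: hinit.1.
exact: (step_coherent (p := (chain s, dt (nleft s))) IHs).1.
Qed.

Lemma chain_coherent s s' : s <= s' -> sim (C s) (C s') (d s) (take (size (d s)) (d s')).
Proof.
move=> le_ss'; rewrite -(subnKC le_ss'); elim: (s' - s) => [|n IHn].
  by rewrite addn0 take_size; apply: sim_refl; apply: chain_dom.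
set r := s + n in IHn; rewrite addnS -/r.
have le_sr : size (d s) <= size (d r).
  by rewrite !size_chain; case: ne; rewrite // ltnS leq_addr.
have h := (step_coherent (p := (chain r, dt (nleft r))) (chain_dom r)).2.
(* Truncation is treated as selecting an initial segment of positions, so that [sim_sel] applies to
   it. *)
have hi : all (gtn (size (d r))) (iota 0 (size (d s))).
  by apply/allP => i; rewrite mem_iota add0n /= => lti; apply: leq_trans lti le_sr.
have := sim_sel h hi; rewrite /sel !map_nth_iota0 //= ?size_take_min ?minnn.
  by rewrite take_takel // => /(sim_trans IHn).
rewrite leq_min le_sr /=; apply: leq_trans le_sr _.
by rewrite -[X in _ <= size X]/(d r.+1) !size_chain; case: ne.
Qed.

(** Coherence keeps the type of the entries [J], so the task is still feasible at the later stage
    [r] that attends to it, and the entry appended there solves it. *)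
Lemma chain_extend s k J b x :
  all (gtn (size (d s))) J -> sim (C s) (A k) (sel (d s) J) b -> dom (A k) x ->
  exists s' e, [/\ s <= s', e < size (d s') &
    sim (C s') (A k) (rcons (sel (d s') J) (nth 0 (d s') e)) (rcons b x)].
Proof.
move=> ltJ hb kx; pose t : task := (J, k, b, x).
have [r le_sr def_r] : exists2 r, s <= r & nleft r = pickle t.
  exists (npair (pickle t) s); first exact: ltnW (ltn_npairr _ _).
  by rewrite nleftK.
have ltJr : all (fun j => j < size (d r)) J.
  apply: sub_all ltJ => j /= lt; apply: leq_trans lt _.
  by rewrite !size_chain; case: ne.
have hc : sim (C s) (C r) (sel (d s) J) (sel (d r) J).
  have := sim_sel (chain_coherent le_sr) ltJ; congr (sim _ _ _ _).
  by apply/eq_in_map => j /(allP ltJ) /= ltj; rewrite nth_take.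
have fr : feasible (chain r, t).
  rewrite /feasible /= !simb_dom chain_dom ltJr /= kx !andbT.
  by apply/simbP; apply: sim_trans (sim_sym hc) hb.
have /andP[/simbP h1 /simbP h2] := amP fr.
exists r.+1, (size (am (chain r, t)).1.2).
have -> : chain r.+1 = ((am (chain r, t)).1.1, rcons (am (chain r, t)).1.2 (am (chain r, t)).2).
  by rewrite [chain r.+1]/= def_r dtK /step fr.
rewrite /= size_rcons nth_rcons ltnn eqxx sel_rcons.
  by split=> //; apply: leqW.
by rewrite -(sim_size h1).
Qed.

(** * Computability, age and homogeneity of the limit *)

Definition effective_limit : wstructure L := limit hne (fun s => ex_intro _ (chain s).1 erefl)
  size_chain chain_coherent chain_extend.

Local Notation M := effective_limit.

(** A constant on which the hints for [cmp] can match. *)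
Definition tuple_at s := d s.

Lemma cmp_tuple_at (T : countType) (s : T -> nat) : cmp s -> cmp (fun x => tuple_at (s x)).
Proof.
move=> hs; have hc V a := @cmp_comp X V _ _ _ a cmp_chain.
by rewrite /tuple_at; cmp.
Qed.

#[local] Hint Extern 1 (computable _ (fun x => tuple_at _)) => apply: cmp_tuple_at : cmp.

Lemma cmp_pos (T : countType) (s i : T -> nat) :
  cmp s -> cmp i -> cmp (fun x => pos tuple_at (s x) (i x)).
Proof.
by move=> hs hi; rewrite /pos; cmp.
Qed.

#[local] Hint Extern 1 (computable _ (fun x => pos _ _ _)) => apply: cmp_pos : cmp.

Lemma cmp_mdom (T : countType) (i : T -> nat) :
  cmp i -> cmp (fun x => mdom tuple_at ne (i x)).
Proof.
move=> hi; have hi' V a := @cmp_comp X V _ _ _ a hi.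
by rewrite /mdom /eqp; cmp.
Qed.

#[local] Hint Extern 1 (computable _ (fun x => mdom _ _ _)) => apply: cmp_mdom : cmp.

(** A witness for [t] consists of a stage [s], a step of the enumeration with index [e s], and a
    certificate that this step yields [g s t]. All three are checked by one program, although the
    enumeration varies with [s]. *)
Lemma ce_stagewise (T : countType) (G : wstructure L -> T -> Prop) (S : T -> Prop)
    (e : nat -> nat) (g : nat -> T -> T) (c : nat -> T -> bool) :
  decodable X T -> cmp e -> cmp (fun p : nat * T => g p.1 p.2) ->
  cmp (fun p : nat * T => c p.1 p.2) ->
  (forall s, enumerates no_oracle (e s) (G (C s))) ->
  (forall t, S t <-> exists s, c s t /\ G (C s) (g s t)) -> ce X S.
Proof.
move=> dT he hg hc hG hS.
have he' V a := @cmp_comp X V _ _ _ a he.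
have hg' V a b := @cmp_comp2 X V _ _ _ g a b hg.
have hc' V a b := @cmp_comp2 X V _ _ _ c a b hc.
pose P t (w : nat * nat * seq entry) :=
  c w.1.1 t && certifies w.2 (e w.1.1) w.1.2 (pickle (g w.1.1 t)).+1.
have dN := decodable_nat X.
apply: (ce_projection (P := P)) => //.
- apply: decodable_pair; first exact: decodable_pair.
  by apply: decodable_seq; apply: decodable_pair => //; apply: decodable_pair.
- by rewrite /P; cmp.
- move=> t; rewrite hS; split=> [[s [cst /(enumerates_certified (hG s))[w [l hl]]]]|].
    by exists (s, w, l); rewrite /P cst.
  case=> -[[s w] l] /andP[/= cst hl]; exists s; split=> //.
  by apply/(enumerates_certified (hG s)); exists w, l.
Qed.

Lemma structure_index_parts e N : structure_index no_oracle e N ->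
  [/\ enumerates no_oracle (nleft (nright e)) (@rel_graph L N),
      enumerates no_oracle (nleft (nright (nright e))) (@nrel_graph L N) &
      enumerates no_oracle (nleft (nright (nright (nright e)))) (@fun_graph L N)].
Proof.
case=> eM [eR [eN [eF [-> _ hR hN hF]]]].
by rewrite !pickle_cons !(nrightK, nleftK).
Qed.

Lemma computable_limit : computable_structure X M.
Proof.
have hi s := structure_index_parts (let: And3 h _ _ := hA (chain s).1 in h).
have hag' V a := @cmp_comp X V _ _ _ a cmp_ag.
have hch V a := @cmp_comp X V _ _ _ a cmp_chain.
have dN := decodable_nat X; have dS := decodable_seq dN.
have dR := decodable_pair dN dS; have dF := decodable_pair dR dN.
have [eM hM] : exists e, decides X e (dom M).
  have [p hp] : cmp (mdom tuple_at ne) by cmp.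
  by exists (encode p) => n; exists p => //; apply: hp.
have [eR hR] : ce X (@rel_graph L M).
  apply: (ce_stagewise (G := @rel_graph L) (g := fun s t => (t.1, map (pos tuple_at s) t.2))
    (e := fun s => nleft (nright (ag (chain s).1).2))
    (c := fun s t => all (mdom tuple_at ne) t.2 && all (fun i => i <= s) t.2)) => //; try cmp.
    by move=> s; case: (hi s).
  case=> R t; rewrite rel_graph_limit; split=> -[s].
    by case=> h1 h2 h3; exists s; rewrite /= h1.
  by case=> /andP[]; exists s.
have [eN hN] : ce X (@nrel_graph L M).
  apply: (ce_stagewise (G := @nrel_graph L) (g := fun s t => (t.1, map (pos tuple_at s) t.2))
    (e := fun s => nleft (nright (nright (ag (chain s).1).2)))
    (c := fun s t => all (mdom tuple_at ne) t.2 && all (fun i => i <= s) t.2)) => //; try cmp.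
    by move=> s; case: (hi s).
  case=> R t; rewrite nrel_graph_limit; split=> -[s].
    by case=> h1 h2 h3; exists s; rewrite /= h1.
  by case=> /andP[]; exists s.
have [eF hF] : ce X (@fun_graph L M).
  apply: (ce_stagewise (G := @fun_graph L)
    (g := fun s t => (t.1.1, map (pos tuple_at s) t.1.2, pos tuple_at s t.2))
    (e := fun s => nleft (nright (nright (nright (ag (chain s).1).2))))
    (c := fun s t => all (mdom tuple_at ne) (t.2 :: t.1.2) &&
                     all (fun i => i <= s) (t.2 :: t.1.2))) => //; try cmp.
    by move=> s; case: (hi s).
  case=> -[F t] y; rewrite fun_graph_limit; split=> -[s].
    by case=> h1 h2 h3; exists s; split=> //; apply/andP.
  by case=> /andP[]; exists s.
by exists (pickle [:: eM; eR; eN; eF]), eM, eR, eN, eF.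
Qed.

(** Tuples with the same atomic type generate isomorphic structures. A generating tuple of [A k] is
    realized in the limit by universality; conversely, a tuple of the limit has the type of one in
    some [C s], and HP applies there. *)
Lemma age_limit B : K B <-> age_of M B.
Proof.
split=> [/AK[k Bk]|[n [a Ba]]].
  have [_ _ [n [t [_ gt]]]] := hA k.
  have h0 l : sim (A l) (A k) [::] [::] := sim_nil hJEP KA l k.
  have [b] := limit_universal hne (fun s => ex_intro _ (chain s).1 erefl)
    size_chain chain_coherent chain_extend h0 (dom_nats t).
  case/simP=> u _ ut; exists n, u.
  apply: isomorphic_trans Bk _.
  apply: isomorphic_trans (isomorphic_sym (generates_isomorphic gt)) _.
  by have [f ifm _] := simeq_isomorphism (simeq_sym ut); exists f.
pose s := foldr maxn 0 (nats a); have les : all (geq s) (nats a) := all_geq_max _.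
have h : sim M (C s) (nats a) (map (pos tuple_at s) (nats a)).
  by apply: sim_limit => //; apply: (dom_nats a).
case/sim_sym/simP: h => u _ ua.
have [f ifm _] := simeq_isomorphism ua.
have [_ hiso] := hK; apply: (hiso (clS u)).
  by apply: hHP; [apply: KA | apply: clS_fg].
apply: isomorphic_sym; apply: isomorphic_trans Ba _; apply: isomorphic_sym.
by exists f.
Qed.

(** At a stage beyond all positions involved, types in the limit become types in one member of the
    age, so a single oracle query decides. *)
Definition simM (b c : seq nat) : bool :=
  let s := foldr maxn 0 (b ++ c) in
  simb (chain s).1 (map (pos tuple_at s) b) (chain s).1 (map (pos tuple_at s) c).

Lemma simMP b c : all (dom M) b -> all (dom M) c -> reflect (sim M M b c) (simM b c).
Proof.
move=> db dc; rewrite /simM; set s := foldr _ _ _.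
have : all (geq s) (b ++ c) := all_geq_max _.
rewrite all_cat => /andP[leb lec].
apply: (iffP (simbP _ _ _ _)) => h.
  exact/(sim_limit2 hne (fun s => ex_intro _ (chain s).1 erefl)
    size_chain chain_coherent chain_extend leb lec db dc).
exact/(sim_limit2 hne (fun s => ex_intro _ (chain s).1 erefl)
    size_chain chain_coherent chain_extend leb lec db dc).
Qed.

Definition piso (z : seq (nat * nat)) : bool :=
  [&& all (mdom tuple_at ne) (unzip1 z), all (mdom tuple_at ne) (unzip2 z) &
      simM (unzip1 z) (unzip2 z)].

Lemma pisoP z : reflect (sim M M (unzip1 z) (unzip2 z)) (piso z).
Proof.
apply: (iffP and3P) => [[d1 d2 /(simMP d1 d2)] //|h].
have d1 := sim_doml h; have d2 := sim_domr h.
by split=> //; apply/(simMP d1 d2).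
Qed.

Lemma cmp_piso (T : countType) (z : T -> seq (nat * nat)) :
  cmp z -> cmp (fun x => piso (z x)).
Proof.
move=> hz; have hc V a := @cmp_comp X V _ _ _ a cmp_chain.
have hz' V a := @cmp_comp X V _ _ _ a hz.
by rewrite /piso /simM; cmp.
Qed.

#[local] Hint Extern 1 (computable _ (fun x => piso _)) => apply: cmp_piso : cmp.

Lemma ultrahomogeneous_limit : computably_ultrahomogeneous X M.
Proof.
have dN := decodable_nat X.
pose F (p : seq (nat * nat) * nat) y :=
  piso p.1 && mdom tuple_at ne p.2 ==> piso (rcons p.1 (p.2, y)).
pose B (p : seq (nat * nat) * nat) y :=
  piso p.1 && mdom tuple_at ne p.2 ==> piso (rcons p.1 (y, p.2)).
have exF p : exists y, F p y.
  rewrite /F; case: (boolP (_ && _)) => [/andP[/pisoP hz dx]|]; last by exists 0.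
  have [y _ h] := limit_homogeneous hz dx.
  by exists y; apply/pisoP; rewrite /unzip1 /unzip2 !map_rcons.
have exB p : exists y, B p y.
  rewrite /B; case: (boolP (_ && _)) => [/andP[/pisoP hz dx]|]; last by exists 0.
  have [y _ h] := limit_homogeneous (sim_sym hz) dx.
  by exists y; apply/pisoP; rewrite /unzip1 /unzip2 !map_rcons; apply: sim_sym.
have [fw hfw fwP] : exists2 fw : seq (nat * nat) * nat -> nat, cmp fw & forall p, F p (fw p).
  by apply: cmp_choice => //; rewrite /F; cmp.
have [bw hbw bwP] : exists2 bw : seq (nat * nat) * nat -> nat, cmp bw & forall p, B p (bw p).
  by apply: cmp_choice => //; rewrite /B; cmp.
have hfw' V a := @cmp_comp X V _ _ _ a hfw.
have hbw' V a := @cmp_comp X V _ _ _ a hbw.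
pose forth n z := if mdom tuple_at ne n then rcons z (n, fw (z, n)) else z.
pose back n z := if mdom tuple_at ne n then rcons z (bw (z, n), n) else z.
(* A bijection must be returned even if the two tuples differ in type; the back-and-forth then
   starts from the empty map. *)
pose z0 (ab : seq nat * seq nat) := if piso (zip ab.1 ab.2) then zip ab.1 ab.2 else [::].
(* Step [n] puts the element [n] into both the domain and the range, so [x] is treated in
   [Z ab x.+1]. *)
pose Z ab n := nat_rect (fun _ => seq (nat * nat)) (z0 ab) (fun n z => back n (forth n z)) n.
have cmp_z0 : cmp z0.
  have hzip : cmp (fun ab : seq nat * seq nat => zip ab.1 ab.2) by apply: (cmp_zip 0 0); cmp.
  by rewrite /z0; cmp.
have cmp_Z : cmp (fun p : (seq nat * seq nat) * nat => Z p.1 p.2).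
  have hz0 V a := @cmp_comp X V _ _ _ a cmp_z0.
  have cmp_forth : cmp (fun p : nat * seq (nat * nat) => forth p.1 p.2) by rewrite /forth; cmp.
  have cmp_back : cmp (fun p : nat * seq (nat * nat) => back p.1 p.2) by rewrite /back; cmp.
  have hforth V a b := @cmp_comp2 X V _ _ _ forth a b cmp_forth.
  have hback V a b := @cmp_comp2 X V _ _ _ back a b cmp_back.
  by apply: (cmp_nat_rect (F := fun _ n z => back n (forth n z))); cmp.
pose H ab x := lookup (Z ab x.+1) x.
have cmp_H : cmp (fun p : (seq nat * seq nat) * nat => H p.1 p.2).
  have hZ V a b := @cmp_comp2 X V _ _ _ Z a b cmp_Z.
  by rewrite /H /lookup; cmp.
have [v cmp_v vP] := smn cmp_H.
have [g hg] := cmp_Phi cmp_v.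
have pforth n z : piso z -> piso (forth n z).
  rewrite /forth; case: ifP => // dn hz; have := fwP (z, n).
  by rewrite /F hz dn.
have pback n z : piso z -> piso (back n z).
  rewrite /back; case: ifP => // dn hz; have := bwP (z, n).
  by rewrite /B hz dn.
have piso_nil : piso [::] by rewrite /piso /= /simM /= simb_dom.
have pZ ab n : piso (Z ab n).
  elim: n => [|n IHn]; first by rewrite /Z /z0 /=; case: ifP.
  exact/pback/pforth.
have sforth n z : {subset z <= forth n z}.
  by move=> p pz; rewrite /forth; case: ifP; rewrite // mem_rcons in_cons pz orbT.
have sback n z : {subset z <= back n z}.
  by move=> p pz; rewrite /back; case: ifP; rewrite // mem_rcons in_cons pz orbT.
exists g => n a b; pose ab := (nats a, nats b).
have [||||h [hval bh ih hZ]] := @back_and_forth L M (Z ab).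
- by move=> m; apply/pisoP.
- by move=> m p pz; apply/sback/sforth.
- move=> x dx; have xf : x \in unzip1 (forth x (Z ab x)).
    rewrite /forth [mdom _ _ _]dx /unzip1 map_rcons mem_rcons.
    exact: mem_head.
  case/mapP: xf => p pz def_x; rewrite [X in X \in _]def_x; apply: map_f.
  exact: sback pz.
- by move=> x dx; rewrite /= /back [mdom _ _ _]dx /unzip2 map_rcons mem_rcons mem_head.
exists (v ab), h; split=> [|x||hab] //.
  by rewrite hval; apply: vP.
split=> //; apply: extends_transfer_isomorphism => // i; apply: (hZ 0).
have e1 : unzip1 (zip (nats a) (nats b)) = nats a by rewrite unzip1_zip // !size_nats.
have e2 : unzip2 (zip (nats a) (nats b)) = nats b by rewrite unzip2_zip // !size_nats.
have pab : piso (zip (nats a) (nats b)) by apply/pisoP; rewrite e1 e2; apply/sim_nats.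
rewrite /Z /= /z0 /= pab -[val (tnth a i)]nth_nats -[val (tnth b i)]nth_nats.
rewrite -nth_zip ?size_nats //; apply: mem_nth.
by rewrite size_zip !size_nats minnn.
Qed.

Lemma Fraisse_limit : computable_Fraisse_limit X KK M.
Proof.
split; [exact: computable_limit | exact: ultrahomogeneous_limit |].
have [h1 h2 h3 h4] := hKK; split=> // [a e i /h3[N [iN /age_limit KN hN]]|B /age_limit/h4 //].
by exists N.
Qed.

End Construction.

Theorem corollary6p5 (L : language) (hL : computable_language L)
    (K : structure L -> Prop) (KK : triple -> Prop)
    (hK : is_age K) (hKK : computable_age KK K)
    (hHP : HP K) (hJEP : JEP K) (hAP : AP K) :
  exists M : wstructure L, computable_Fraisse_limit (coded (EI L KK)) KK M.
Proof.
have [ag cmp_ag hag] := computable_representation hKK.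
have /choice[A hA] : forall k, exists N : wstructure L,
    [/\ structure_index no_oracle (ag k).2 N, K N &
        exists n (t : n.-tuple N), nats t = (ag k).1 /\ generates t].
  move=> k; have [_ _ h _] := hKK; have := hag k.
  by case: (ag k) => a e /h.
have [am cmp_am amP] := computable_amalgamation hKK hHP hAP cmp_ag hag hA.
have [dt dtK cmp_dt] : decodable (coded (EI L KK)) task.
  have dN := decodable_nat (coded (EI L KK)); have dS := decodable_seq dN.
  by do ![apply: decodable_pair => //].
(* Whether some [A k] is nonempty is settled by excluded middle, not computed: [ne] and [init] enter
   the programs as constants. *)
have [ne [init [hne hinit]]] : exists (ne : bool) (init : state),
    (forall k x, dom (A k) x -> ne) /\
    (all (dom (A init.1)) init.2 /\ size init.2 = ne).
  have [[k [x kx]]|none] := pselect (exists k x, dom (A k) x).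
    by exists true, (k, [:: x]); rewrite /= kx.
  exists false, (0, [::]); split=> // k x kx.
  by case: none; exists k, x.
have h := Fraisse_limit hK hKK hHP hJEP cmp_ag hag hA cmp_am amP dtK cmp_dt hne hinit.
by eexists; exact: h.
Qed.
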